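(* Let $\mathcal M$ be a class of compact manifolds that is finitely axiomatized, and let $\mathrm{axiom}(\mathcal M)$ be the set of Gödel numbers $\#\phi$ of first-order sentences $\phi$ in the language of groups that finitely axiomatize $\mathcal M$. Then $\mathrm{axiom}(\mathcal M)$ is not definable in second-order arithmetic.
   Context: All manifolds are compact, connected, second countable topological manifolds of positive dimension, possibly with boundary, up to homeomorphism. A class $\mathcal M$ of such manifolds is finitely axiomatized if there is a first-order sentence $\phi$ in the language of group theory such that for every compact manifold $M$, $M\in\mathcal M$ iff $\mathrm{Homeo}(M)\models\phi$; such $\phi$ is said to finitely axiomatize $\mathcal M$ (the empty class is allowed). A fixed computable Gödel numbering $\phi\mapsto\#\phi$ of sentences is used; a set of natural numbers is definable in second-order arithmetic if defined by a formula of second-order arithmetic with one free number variable. *)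

(* Defs.v *)
From HB Require Import structures.
From mathcomp Require Import all_boot all_order all_algebra.
From mathcomp Require Import all_classical all_reals all_analysis.
From mathcomp Require Import Rstruct Rstruct_topology.
From Stdlib Require Import Rdefinitions.

Set Implicit Arguments.
Unset Strict Implicit.
Unset Printing Implicit Defensive.

Import Order.TTheory GRing.Theory Num.Theory.
Local Open Scope classical_set_scope.
Local Open Scope ring_scope.

Definition halfspace (m : nat) : set 'rV[Rdefinitions.R]_(m.+1) :=
  [set v | 0 <= v ord0 ord0].

Definition homeo_between {X Y : topologicalType} (A : set X) (B : set Y)
    (f : X -> Y) : Prop :=
  exists g : Y -> X,
    [/\ (forall x, A x -> B (f x)), (forall y, B y -> A (g y)),
        (forall x, A x -> g (f x) = x), (forall y, B y -> f (g y) = y) &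
        ({within A, continuous f} /\ {within B, continuous g})].

Definition compact_manifold (T : topologicalType) : Prop :=
  [/\ hausdorff_space T, @second_countable T, compact [set: T],
      connected [set: T] /\ (exists x : T, True) &
      exists m : nat, forall x : T,
        exists (U : set T) (W : set 'rV[Rdefinitions.R]_(m.+1))
               (phi : T -> 'rV[Rdefinitions.R]_(m.+1)),
          [/\ open U, U x, open W & homeo_between U (W `&` @halfspace m) phi]].

Definition homeomorphic (T T' : topologicalType) : Prop :=
  exists (f : T -> T') (g : T' -> T),
    [/\ continuous f, continuous g, cancel f g & cancel g f].

Inductive gterm : Type :=
  | GVar of nat
  | GOne
  | GMul of gterm & gterm
  | GInv of gterm.

Inductive gform : Type :=
  | GEq of gterm & gterm
  | GNot of gform
  | GAnd of gform & gform
  | GOr of gform & gform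
  | GImp of gform & gform
  | GAll of nat & gform
  | GEx of nat & gform.

(** A group (structure for the language {., ^-1, 1, =}); equality symbol is
    interpreted by [geq] (for Homeo(M): equality of the underlying maps). *)
Record group_model : Type := GroupModel {
  gcar : Type;
  geq : gcar -> gcar -> Prop;
  gmul : gcar -> gcar -> gcar;
  ginv : gcar -> gcar;
  gone : gcar }.

Definition upd {A : Type} (e : nat -> A) (n : nat) (a : A) : nat -> A :=
  fun k => if k == n then a else e k.

Fixpoint geval (G : group_model) (e : nat -> gcar G) (t : gterm) : gcar G :=
  match t with
  | GVar n => e n
  | GOne => gone G
  | GMul s u => gmul (geval e s) (geval e u)
  | GInv s => ginv (geval e s)
  end.

Fixpoint gsat (G : group_model) (e : nat -> gcar G) (p : gform) : Prop :=
  match p with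
  | GEq s t => geq (geval e s) (geval e t)
  | GNot q => ~ gsat e q
  | GAnd q r => gsat e q /\ gsat e r
  | GOr q r => gsat e q \/ gsat e r
  | GImp q r => gsat e q -> gsat e r
  | GAll n q => forall a : gcar G, gsat (upd e n a) q
  | GEx n q => exists a : gcar G, gsat (upd e n a) q
  end.

Fixpoint gterm_free (k : nat) (t : gterm) : bool :=
  match t with
  | GVar n => n == k
  | GOne => false
  | GMul s u => gterm_free k s || gterm_free k u
  | GInv s => gterm_free k s
  end.

Fixpoint gform_free (k : nat) (p : gform) : bool :=
  match p with
  | GEq s t => gterm_free k s || gterm_free k t
  | GNot q => gform_free k q
  | GAnd q r | GOr q r | GImp q r => gform_free k q || gform_free k r
  | GAll n q | GEx n q => (n != k) && gform_free k q
  end.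

Definition gsentence (p : gform) : Prop := forall k, ~~ gform_free k p.

(** The fixed computable Goedel numbering, via Cantor pairing. *)
Definition cpair (a b : nat) : nat := ((a + b) * (a + b).+1) %/ 2 + b.

Fixpoint gterm_code (t : gterm) : nat :=
  match t with
  | GVar n => cpair 0 n
  | GOne => cpair 1 0
  | GMul s u => cpair 2 (cpair (gterm_code s) (gterm_code u))
  | GInv s => cpair 3 (gterm_code s)
  end.

Fixpoint godel (p : gform) : nat :=
  match p with
  | GEq s t => cpair 0 (cpair (gterm_code s) (gterm_code t))
  | GNot q => cpair 1 (godel q)
  | GAnd q r => cpair 2 (cpair (godel q) (godel r))
  | GOr q r => cpair 3 (cpair (godel q) (godel r))
  | GImp q r => cpair 4 (cpair (godel q) (godel r))
  | GAll n q => cpair 5 (cpair n (godel q))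
  | GEx n q => cpair 6 (cpair n (godel q))
  end.

Definition is_homeo (T : topologicalType) (f g : T -> T) : Prop :=
  [/\ cancel f g, cancel g f, continuous f & continuous g].

Definition homeo (T : topologicalType) : Type :=
  {f : T -> T & {g : T -> T | is_homeo f g}}.

Lemma is_homeo_id (T : topologicalType) : is_homeo (@id T) id.
Proof. by split => // x; apply: cvg_id. Qed.

Lemma is_homeo_inv (T : topologicalType) (f g : T -> T) :
  is_homeo f g -> is_homeo g f.
Proof. by case=> *; split. Qed.

Lemma is_homeo_comp (T : topologicalType) (f g f' g' : T -> T) :
  is_homeo f g -> is_homeo f' g' -> is_homeo (f \o f') (g' \o g).
Proof.
case=> fg gf cf cg [fg' gf' cf' cg']; split.
- by move=> x /=; rewrite fg fg'.
- by move=> x /=; rewrite gf' gf.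
- by move=> x; apply: continuous_comp; [apply: cf' | apply: cf].
- by move=> x; apply: continuous_comp; [apply: cg | apply: cg'].
Qed.

Definition homeo_one (T : topologicalType) : homeo T :=
  existT _ id (exist _ id (is_homeo_id T)).

Definition homeo_inv (T : topologicalType) (h : homeo T) : homeo T :=
  let: existT f (exist g H) := h in
  existT _ g (exist _ f (is_homeo_inv H)).

Definition homeo_mul (T : topologicalType) (h h' : homeo T) : homeo T :=
  let: existT f (exist g H) := h in
  let: existT f' (exist g' H') := h' in
  existT _ (f \o f') (exist _ (g' \o g) (is_homeo_comp H H')).

Definition Homeo (T : topologicalType) : group_model :=
  @GroupModel (homeo T) (fun h h' => forall x, projT1 h x = projT1 h' x)
    (@homeo_mul T) (@homeo_inv T) (homeo_one T).

(** Homeo(T) |= phi, for a sentence phi (the environment is irrelevant). *)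
Definition models_homeo (T : topologicalType) (p : gform) : Prop :=
  gsat (G := Homeo T) (fun _ => homeo_one T) p.

Definition mclass := forall T : topologicalType, Prop.

Definition axiomatizes (C : mclass) (p : gform) : Prop :=
  gsentence p /\
  forall T : topologicalType, compact_manifold T -> (C T <-> models_homeo T p).

Definition finitely_axiomatized (C : mclass) : Prop :=
  exists p : gform, axiomatizes C p.

Definition axiom_set (C : mclass) (n : nat) : Prop :=
  exists p : gform, axiomatizes C p /\ godel p = n.

Inductive aterm : Type :=
  | AVar of nat
  | AZero
  | ASucc of aterm
  | APlus of aterm & aterm
  | ATimes of aterm & aterm.

Inductive aform : Type :=
  | AEq of aterm & aterm
  | ALt of aterm & aterm
  | AMem of aterm & nat
  | ANot of aform
  | AAnd of aform & aform
  | AOr of aform & aform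
  | AImp of aform & aform
  | AAllN of nat & aform
  | AExN of nat & aform
  | AAllS of nat & aform
  | AExS of nat & aform.

Fixpoint aeval (e : nat -> nat) (t : aterm) : nat :=
  match t with
  | AVar n => e n
  | AZero => 0%N
  | ASucc s => (aeval e s).+1
  | APlus s u => (aeval e s + aeval e u)%N
  | ATimes s u => (aeval e s * aeval e u)%N
  end.

Fixpoint asat (e : nat -> nat) (s : nat -> nat -> Prop) (p : aform) : Prop :=
  match p with
  | AEq t u => aeval e t = aeval e u
  | ALt t u => leq (aeval e t).+1 (aeval e u)
  | AMem t k => s k (aeval e t)
  | ANot q => ~ asat e s q
  | AAnd q r => asat e s q /\ asat e s r
  | AOr q r => asat e s q \/ asat e s r
  | AImp q r => asat e s q -> asat e s r
  | AAllN n q => forall a : nat, asat (upd e n a) s q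
  | AExN n q => exists a : nat, asat (upd e n a) s q
  | AAllS k q => forall X : nat -> Prop, asat e (upd s k X) q
  | AExS k q => exists X : nat -> Prop, asat e (upd s k X) q
  end.

Fixpoint aterm_free (k : nat) (t : aterm) : bool :=
  match t with
  | AVar n => n == k
  | AZero => false
  | ASucc s => aterm_free k s
  | APlus s u | ATimes s u => aterm_free k s || aterm_free k u
  end.

Fixpoint aform_freeN (k : nat) (p : aform) : bool :=
  match p with
  | AEq t u | ALt t u => aterm_free k t || aterm_free k u
  | AMem t _ => aterm_free k t
  | ANot q => aform_freeN k q
  | AAnd q r | AOr q r | AImp q r => aform_freeN k q || aform_freeN k r
  | AAllN n q | AExN n q => (n != k) && aform_freeN k q
  | AAllS _ q | AExS _ q => aform_freeN k q
  end.

Fixpoint aform_freeS (k : nat) (p : aform) : bool :=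
  match p with
  | AEq _ _ | ALt _ _ => false
  | AMem _ X => X == k
  | ANot q => aform_freeS k q
  | AAnd q r | AOr q r | AImp q r => aform_freeS k q || aform_freeS k r
  | AAllN _ q | AExN _ q => aform_freeS k q
  | AAllS X q | AExS X q => (X != k) && aform_freeS k q
  end.

Definition so_definable (A : nat -> Prop) : Prop :=
  exists psi : aform,
    [/\ (forall k, k != 0%N -> ~~ aform_freeN k psi),
        (forall k, ~~ aform_freeS k psi) &
        forall n : nat, A n <-> asat (fun _ => n) (fun _ _ => False) psi].

(* Main.v *)
(* The idea: the sentences true in Homeo(M) for all compact manifolds M are as complicated as
   full second-order arithmetic.

   If phi axiomatizes C, then "phi <-> theta" axiomatizes C exactly when theta holds in all
   Homeo(M), so that it suffices to interpret second-order arithmetic in Homeo(M) with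
   parameters t, c, r that satisfy a first-order condition chi, uniformly in M, and to satisfy
   chi for one M. A formula in the style of Rubin expresses, up to twelfth powers, that two
   homeomorphisms have disjoint supports. With b = c^12, the number n is the translate
   t^n b t^-n of b; these translates have disjoint supports, and q = b r^12 agrees with each of
   them on its support. A set A of numbers is a homeomorphism y that agrees with q on the
   supports of the translates in A and is the identity elsewhere; y is continuous because
   manifolds are locally connected. Addition is the group multiplication, multiplication is
   defined from addition and divisibility, and chi makes the interpretation standard. It holds
   for the extended real line, with t the shift by 1, c supported in (0, 1), and r supported
   in the union of the other intervals between consecutive integers. *)
Require Import Defs.
From mathcomp Require Import all_boot all_order all_algebra.
From mathcomp Require Import all_classical all_reals all_analysis.
From mathcomp Require Import Rstruct Rstruct_topology.
From mathcomp Require Import ring lra zify.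

Set Implicit Arguments.
Unset Strict Implicit.
Unset Printing Implicit Defensive.

Import Order.TTheory GRing.Theory Num.Theory.
Import numFieldNormedType.Exports.
Local Open Scope classical_set_scope.

(** * Homeomorphism groups *)

(** The contradiction comes from a diagonal sentence L of the form [phi <-> I], where I says, for
    all good parameters, that the code of L is not in axiom(C). Good parameters code standard
    arithmetic, so the body of I has the same truth value in every manifold and for every choice of
    them. If L is not in axiom(C), then I holds in all manifolds, vacuously where there are no good
    parameters, and L axiomatizes C. If L is in axiom(C), then I holds on the extended real line,
    where good parameters exist, and this refutes the assumption. One manifold with good parameters
    is thus enough, whether or not it belongs to C.

    The obstacle in coding sets is that infinitely many disjoint supports may accumulate, where a
    homeomorphism glued from unrelated pieces can fail to be continuous. The parameter r is there
    for this: it completes b to a single homeomorphism q that contains all the translates. A map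
    glued from q and the identity can break only inside the support of q, because q fixes all other
    points, and inside that support local connectedness separates the translates from the rest. *)

Definition homeo_fun (T : topologicalType) (h : homeo T) : T -> T := projT1 h.
Coercion homeo_fun : homeo >-> Funclass.

Declare Scope homeo_scope.
Delimit Scope homeo_scope with H.
Local Open Scope homeo_scope.
Infix "**" := (@homeo_mul _) (at level 40, left associativity) : homeo_scope.
Notation "x ^V" := (@homeo_inv _ x) (at level 2, format "x ^V") : homeo_scope.

Section Group.
Variable T : topologicalType.
Implicit Types (f g h x y : homeo T) (z : T).

Definition mk_homeo (u v : T -> T) (H : is_homeo u v) : homeo T :=
  existT (fun u => {v : T -> T | is_homeo u v}) u (exist _ v H).

(** The inverse stored in a homeomorphism is determined by the map, and its proof is irrelevant.
    Hence the equality [geq] of the model [Homeo T] can be replaced by Leibniz equality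
    throughout. *)
Lemma homeo_ext f g : f =1 g -> f = g.
Proof.
case: f g => [f [f' Hf]] [g [g' Hg]]; rewrite /homeo_fun /= => fg.
have E : f = g by apply: funext.
subst g.
have E : f' = g'.
  apply: funext => z; case: Hf Hg => K1 K2 _ _ [K3 K4 _ _].
  by apply: (can_inj K1); rewrite K2 K4.
by subst g'; rewrite (Prop_irrelevance Hf Hg).
Qed.

Lemma homeo_mulE f g z : (f ** g) z = f (g z).
Proof. by case: f g => [f [f' Hf]] [g [g' Hg]]. Qed.

Lemma homeo_oneE z : homeo_one T z = z.
Proof. by []. Qed.

Lemma homeoK f : cancel f f^V.
Proof. by case: f => [f [f' []]]. Qed.

Lemma homeoVK f : cancel f^V f.
Proof. by case: f => [f [f' []]]. Qed.

Lemma homeo_continuous f : continuous f.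
Proof. by case: f => [f [f' []]]. Qed.

Lemma homeo_inj f : injective f.
Proof. exact: can_inj (homeoK f). Qed.

Lemma homeo_mul1 f : f ** homeo_one T = f.
Proof. by apply: homeo_ext => z; rewrite !homeo_mulE. Qed.

Definition commutes f g := f ** g = g ** f.

Lemma commutesP f g : commutes f g <-> forall z, f (g z) = g (f z).
Proof.
split=> [fg z|fg]; first by rewrite -!homeo_mulE fg.
by apply: homeo_ext => z; rewrite !homeo_mulE.
Qed.

Lemma commutes_sym f g : commutes f g -> commutes g f.
Proof. exact: esym. Qed.

Lemma commutesV f g : commutes f g -> commutes f^V g.
Proof.
by move=> /commutesP fg; apply/commutesP => z; apply: (homeo_inj (f := f)); rewrite fg !homeoVK.
Qed.

Lemma commutesM f g h : commutes f h -> commutes g h -> commutes (f ** g) h.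
Proof.
by move=> /commutesP fh /commutesP gh; apply/commutesP => z; rewrite !homeo_mulE gh fh.
Qed.

Definition homeo_pow f n := iter n (homeo_mul f) (homeo_one T).

Global Arguments homeo_pow : simpl never.

Lemma homeo_powS f n : homeo_pow f n.+1 = f ** homeo_pow f n.
Proof. by []. Qed.

Lemma homeo_powE f n z : homeo_pow f n z = iter n f z.
Proof. by elim: n => //= n IH; rewrite homeo_powS homeo_mulE IH. Qed.

Lemma homeo_powD f m n : homeo_pow f (m + n) = homeo_pow f m ** homeo_pow f n.
Proof. by apply: homeo_ext => z; rewrite homeo_mulE !homeo_powE iterD. Qed.

Lemma commutes_pow f g n : commutes f g -> commutes (homeo_pow f n) g.
Proof. by move=> fg; elim: n => [|n IH]; [exact/commutesP|exact: commutesM]. Qed.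

Definition hconj x f := x ** f ** x^V.

Lemma hconjE x f z : hconj x f z = x (f (x^V z)).
Proof. by rewrite !homeo_mulE. Qed.

Lemma hconjM x y f : hconj (x ** y) f = hconj x (hconj y f).
Proof.
apply: homeo_ext => z; rewrite !hconjE !homeo_mulE; congr (x (y (f _))).
by apply: (homeo_inj (f := x ** y)); rewrite homeoVK homeo_mulE !homeoVK.
Qed.

Lemma hconj1 f : hconj (homeo_one T) f = f.
Proof. by apply: homeo_ext => z; rewrite hconjE. Qed.

Lemma hconj_inj x f g : hconj x f = hconj x g -> f = g.
Proof.
move=> fg; apply: homeo_ext => z; apply: (homeo_inj (f := x)).
by have := congr1 (fun h : homeo T => h (x z)) fg; rewrite !hconjE homeoK.
Qed.

Definition hcomm f g := f ** g ** f^V ** g^V.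

Definition supp f : set T := [set z | f z <> z].

Lemma notsupp f z : ~ supp f z -> f z = z.
Proof. exact: contrapT. Qed.

Lemma supp_image f z : supp f z -> supp f (f z).
Proof. by move=> fz /homeo_inj. Qed.

Lemma supp_V f z : supp f^V z -> supp f z.
Proof. by move=> fz /(congr1 f^V); rewrite homeoK => /esym. Qed.

Lemma supp_commutes x f z : commutes x f -> supp f z <-> supp f (x z).
Proof.
move=> /commutesP xf; rewrite /supp /= -xf.
by split=> [H /homeo_inj|H E]; [|apply: H; rewrite E].
Qed.

Lemma supp_iter f z n : supp (homeo_pow f n) z -> supp f z.
Proof.
by move=> H fz; apply: H; rewrite homeo_powE; elim: n => //= n ->.
Qed.

Lemma supp_conj x f z : supp (hconj x f) z <-> supp f (x^V z).
Proof.
rewrite /supp /= hconjE; split=> [H E|H E]; apply: H.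
  by rewrite E homeoVK.
by apply: (homeo_inj (f := x)); rewrite E homeoVK.
Qed.

(** * Disjointness of supports in the language of groups *)

Definition disjoint_supp f g := forall z, supp f z -> ~ supp g z.

Lemma disjoint_commutes f g : disjoint_supp f g -> commutes f g.
Proof.
move=> fg; apply/commutesP => z; have [fz|/notsupp fz] := pselect (supp f z).
  by rewrite (notsupp (fg _ fz)) (notsupp (fg _ (supp_image fz))).
rewrite fz; have [gz|/notsupp gz] := pselect (supp g z); last by rewrite gz.
by apply: notsupp => /fg; apply; apply: supp_image.
Qed.

(** An [h] that does not commute with [f] must move a point of the support of [f]. If [g] is the
    identity there, maps supported near that point commute with [g] and still yield a nontrivial
    double commutator with [h]. *)
Definition detached f g := forall h, ~ commutes h f ->
  exists f1 f2, [/\ commutes f1 g, commutes f2 g,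
    commutes (hcomm f1 (hcomm f2 h)) g & hcomm f1 (hcomm f2 h) <> homeo_one T].

Definition locally_moving := forall V : set T, open V -> V !=set0 ->
  exists f, supp f !=set0 /\ supp f `<=` V.

Lemma nontrivial_supp f : f <> homeo_one T -> supp f !=set0.
Proof.
move=> f1; apply: contrapT => H; apply: f1; apply: homeo_ext => z.
by apply: notsupp => fz; apply: H; exists z.
Qed.

Hypothesis haus : hausdorff_space T.

Lemma displaced_nbhd h z (V : set T) : open V -> V z -> h z <> z ->
  exists V', [/\ open V', V' z, V' `<=` V & forall u, V' u -> ~ V' (h u)].
Proof.
move=> oV Vz hz; move: haus; rewrite open_hausdorff.
have /eqP hz' : z <> h z by move=> E; apply: hz.
move=> /(_ _ _ hz') [[A B] /= [/set_mem Az /set_mem Bz] [oA oB AB]].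
exists (V `&` (A `&` h @^-1` B)); split => //.
- apply: openI => //; apply: openI => //.
  by apply: open_comp => // u _; apply: homeo_continuous.
- by move=> u [_ [_ Bu]] [_ [Au _]]; by move/eqP: AB => /seteqP[AB _]; apply: (AB (h u)).
Qed.

Lemma supp_open f : open (supp f).
Proof.
rewrite openE => z fz; have [V [oV Vz _ H]] := displaced_nbhd openT I fz.
apply: filterS (open_nbhs_nbhs (conj oV Vz)) => u Vu E.
by apply: (H _ Vu); rewrite E.
Qed.

Hypothesis moving : locally_moving.

(** [f2] is supported in a set that [f1] moves off itself, so conjugation by [f1] changes [f2]. *)
Lemma noncommuting_pair (V : set T) : open V -> V !=set0 ->
  exists f1 f2, [/\ supp f1 `<=` V, supp f2 `<=` V & ~ commutes f1 f2].
Proof.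
move=> oV V0; have [f1 [[z f1z] f1V]] := moving oV V0.
have [V' [oV' V'z V'V f1V']] := displaced_nbhd oV (f1V _ f1z) f1z.
have [f2 [[u f2u] f2V]] := moving oV' (ex_intro _ z V'z).
exists f1, f2; split=> //; first by move=> ? /f2V /V'V.
move=> /commutesP C; apply: (f2u); apply: (homeo_inj (f := f1)); rewrite C.
by apply: notsupp => /f2V; apply: f1V'; apply: f2V.
Qed.

Lemma homeo_mulVE f g z : (f ** g)^V z = g^V (f^V z).
Proof. by case: f g => [f [f' Hf]] [g [g' Hg]]. Qed.

Lemma hcommE f g z : hcomm f g z = f (g (f^V (g^V z))).
Proof. by rewrite !homeo_mulE. Qed.

Lemma homeo_invK f : f^V^V = f.
Proof. by apply: homeo_ext => z; apply: (homeo_inj (f := f^V)); rewrite homeoVK homeoK. Qed.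

Lemma hcommVE f g z : (hcomm f g)^V z = g (f (g^V (f^V z))).
Proof. by rewrite !homeo_mulVE !homeo_invK. Qed.

(** Some small [V] in the support of [f] is moved off itself by [h]. For [f1] and [f2] supported in
    [V], the conjugate of the inverse of [f2] by [h] lives on the image of [V], commutes with [f1],
    and cancels: the double commutator becomes the commutator of [f1] and [f2]. *)
Lemma disjoint_detached f g : disjoint_supp f g -> detached f g.
Proof.
move=> fg h hf.
have [x [fx hx]] : exists x : T, supp f x /\ h x <> x.
  apply: contrapT => H; apply: hf; apply/commutes_sym/disjoint_commutes => z fz hz.
  by apply: H; exists z.
have [V [oV Vx Vf hV]] := displaced_nbhd (supp_open f) fx hx.
have [f1 [f2 [f1V f2V f12]]] := noncommuting_pair oV (ex_intro _ x Vx).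
have c1 : commutes f1 g by apply: disjoint_commutes => z /f1V/Vf/fg.
have c2 : commutes f2 g by apply: disjoint_commutes => z /f2V/Vf/fg.
pose G := hconj h f2^V.
have Gf1 : commutes f1^V G.
  apply/commutesV/disjoint_commutes => z /f1V Vz /supp_conj/supp_V/f2V.
  by move=> /hV; rewrite homeoVK.
have E : hcomm f1 (hcomm f2 h) = hcomm f1 f2.
  apply: homeo_ext => z; rewrite !hcommE hcommVE.
  have EG u : G (f1^V u) = f1^V (G u) by move/commutesP: Gf1 => ->.
  have := EG (h (f2 (h^V (f2^V z)))); rewrite !hconjE !homeoK => ->.
  by rewrite homeoVK.
exists f1, f2; split => //; rewrite E.
  by do !apply: commutesM => //; apply: commutesV.
move=> w1; apply: f12; apply/commutesP => z.
have := congr1 (fun u : homeo T => u (f2 (f1 z))) w1.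
by rewrite hcommE homeoK homeoK.
Qed.

Lemma iter_fix (g : T -> T) z i k : iter i g z = z -> iter (k * i) g z = z.
Proof. by move=> E; elim: k => // k IH; rewrite mulSn iterD IH. Qed.

(* A point moved by [g ^ 12] has at least five points in its [g]-orbit, while the
   double commutator lives on four translates of the support of [h]. *)
Lemma detached_disjoint f g : detached f g -> disjoint_supp f (homeo_pow g 12).
Proof.
move=> fg x fx gx.
have gj j : 0 < j < 5 -> homeo_pow g j x <> x.
  rewrite homeo_powE => j5 /iter_fix E; apply: gx; rewrite homeo_powE.
  (* 12 is the least common multiple of 1, 2, 3 and 4, so a point fixed by one of the first four
     powers of [g] is fixed by the twelfth. *)
  have -> : 12 = (12 %/ j * j)%N by case: j j5 {E} => [|[|[|[|[|j]]]]].
  exact: E.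
have [V0 [oV0 V0x _ fV0]] := displaced_nbhd openT I fx.
have [V1 [oV1 V1x V10 gV1]] := displaced_nbhd oV0 V0x (@gj 1%N isT).
have [V2 [oV2 V2x V21 gV2]] := displaced_nbhd oV1 V1x (@gj 2%N isT).
have [V3 [oV3 V3x V32 gV3]] := displaced_nbhd oV2 V2x (@gj 3%N isT).
have [V [oV Vx V43 gV4]] := displaced_nbhd oV3 V3x (@gj 4%N isT).
have fV u : V u -> ~ V (f u) by move=> /V43/V32/V21/V10/fV0 H /V43/V32/V21/V10.
have gV j u : 0 < j < 5 -> V u -> ~ V (iter j g u).
  rewrite -homeo_powE; case: j => [|[|[|[|[|j]]]]] // _.
  - by move=> /V43/V32/V21/gV1 H /V43/V32/V21.
  - by move=> /V43/V32/gV2 H /V43/V32.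
  - by move=> /V43/gV3 H /V43.
  - exact: gV4.
have [h [[u hu] hV]] := moving oV (ex_intro _ x Vx).
have hf : ~ commutes h f.
  move=> /commutes_sym C; apply: (fV u) (hV _ hu) _; apply: hV.
  by rewrite -(supp_commutes u C).
have [f1 [f2 [c1 c2 cw /nontrivial_supp [y wy]]]] := fg _ hf.
set w := hcomm f1 _ in cw wy.
(* [w] is a product of conjugates of [h] and its inverse by 1, [f1], [f2] and [f1 ** f2], so it
   moves points only in the four corresponding images of [V]. *)
pose A (a : bool * bool) := (if a.1 then f1 else homeo_one T) ** (if a.2 then f2 else homeo_one T).
have cA a : commutes (A a) g.
  apply: commutesM; first by case: a.1; [|exact/commutesP].
  by case: a.2; [|exact/commutesP].
have hn z : ~ V z -> h z = z by move=> Vz; apply: notsupp => /hV.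
have hVn z : ~ V z -> h^V z = z by move=> Vz; apply: notsupp => /supp_V/hV.
have wA z : supp w z -> exists a, V ((A a)^V z).
  move=> wz; apply: contrapT => H; apply: wz.
  have H1 : ~ V z by move=> Vz; apply: H; exists (false, false); rewrite homeo_mulVE.
  have H2 : ~ V (f1^V z) by move=> Vz; apply: H; exists (true, false); rewrite homeo_mulVE.
  have H3 : ~ V (f2^V z) by move=> Vz; apply: H; exists (false, true); rewrite homeo_mulVE.
  have H4 : ~ V (f2^V (f1^V z)) by move=> Vz; apply: H; exists (true, true); rewrite homeo_mulVE.
  rewrite hcommE hcommVE (hVn _ H3) homeoVK (hn _ H1) hcommE (hVn _ H2) (hn _ H4).
  by rewrite !homeoVK.
have wi i : supp w (iter i g y).
  by elim: i => //= i IH; rewrite -(supp_commutes (f := w) (x := g)) //; apply: commutes_sym.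
(* Pigeonhole: the points y, g y, ..., g^4 y lie in the support of [w], hence in four images of [V].
   Two of them share an image, and pulling back by the corresponding [A a], which commutes with [g],
   gives a point of [V] that g^(j-i) sends into [V]. *)
have [k kP] := choice (fun i : 'I_5 => wA _ (wi i)).
have : ~ injective k by move=> /leq_card; rewrite card_prod card_bool card_ord.
apply=> i j kij; apply: contrapT => /eqP ij.
wlog lij : i j kij ij / (i < j)%N.
  move=> W; case: (ltngtP i j) => [|ji|/val_inj E]; first exact: W.
    by apply: (W j i) => //; rewrite eq_sym.
  by rewrite E eqxx in ij.
apply: (gV (j - i)%N _ _ (kP i)); first by have := ltn_ord j; lia.
have := kP j; rewrite -kij -{1}(subnK (ltnW lij)) iterD -!homeo_powE.
have /commutesP -> // : commutes (A (k i))^V (homeo_pow g (j - i)).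
exact/commutesV/commutes_sym/commutes_pow/commutes_sym.
Qed.

End Group.

(** * The interpretation of arithmetic *)

Lemma connected_sub_open (T : topologicalType) (W A B : set T) :
  connected W -> open A -> open B -> W `<=` A `|` B ->
  (forall z, A z -> ~ B z) -> W `&` A !=set0 -> W `<=` A.
Proof.
move=> cW oA oB WAB AB W0.
have -> : W = W `&` A.
  apply/esym/cW => //; first by exists A.
  exists (~` B); first exact: open_closedC.
  apply/seteqP; split=> z [Wz H]; split => //; first exact: AB.
  by have [] := WAB _ Wz.
by move=> z [].
Qed.

Section Interpretation.
Variable T : topologicalType.
Implicit Types (f g h x y : homeo T) (z : T).

Definition locally_connected := forall z (V : set T), open V -> V z ->
  exists W, [/\ open W, W z, W `<=` V & connected W].

Variables t c r : homeo T.

Definition hb := homeo_pow c 12.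
Definition hq := hb ** homeo_pow r 12.
(** Commuting with [t] makes multiplication act as addition on the translates, and commuting with
    [hq] makes every translate a restriction of [hq]. *)
Definition dom x := commutes x t /\ commutes x hq.
Definition translate x := hconj x hb.
Definition member x y := ~ detached (translate x) y.
(** Dedekind's definition of the natural numbers: [y] ranges over codes of sets, the identity is
    zero and multiplication by [t] is the successor. *)
Definition natural x := dom x /\ forall y, member (homeo_one T) y ->
  (forall h, dom h -> member h y -> member (t ** h) y) -> member x y.
(** The first condition puts [t] in [dom]. The second makes the twelfth power of [r] trivial on the
    support of [hb], so that [hq] agrees with [hb] there. The third makes any two translates equal
    or disjoint, the fourth makes membership detectable in spite of the loss of twelfth powers, and
    the last says that zero is not a successor. *)
Definition good_params :=
  [/\ commutes t hq, detached hb r,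
      forall x, dom x -> translate x = hb \/ detached (translate x) c,
      homeo_pow hb 12 <> homeo_one T &
      forall x, natural x -> translate (t ** x) <> hb].
Definition represents x n := dom x /\ translate x = translate (homeo_pow t n).

Lemma dom_one : dom (homeo_one T).
Proof. by split; apply/commutesP. Qed.

Lemma dom_mul x y : dom x -> dom y -> dom (x ** y).
Proof. by move=> [? ?] [? ?]; split; apply: commutesM. Qed.

Lemma dom_inv x : dom x -> dom x^V.
Proof. by move=> [? ?]; split; apply: commutesV. Qed.

Lemma homeo_mulV x : x^V ** x = homeo_one T.
Proof. by apply: homeo_ext => z; rewrite homeo_mulE homeoK. Qed.

Lemma translate_mul x y : translate (x ** y) = hconj x (translate y).
Proof. exact: hconjM. Qed.

Lemma member_eq x x' y : translate x = translate x' -> member x y -> member x' y.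
Proof. by rewrite /member => ->. Qed.

Lemma homeo_pow_conj x f n : homeo_pow (hconj x f) n = hconj x (homeo_pow f n).
Proof.
elim: n => [|n IH]; first by apply: homeo_ext => z; rewrite hconjE homeo_oneE homeoVK.
by apply: homeo_ext => z; rewrite !homeo_powS IH !homeo_mulE homeoK.
Qed.

Hypothesis haus : hausdorff_space T.
Hypothesis moving : locally_moving T.
Hypothesis lconn : locally_connected.

(** * Numbers and sets coded by translates *)

Section Soundness.
Hypothesis tq : commutes t hq.
Hypothesis br : detached hb r.
Hypothesis disj : forall x, dom x -> translate x = hb \/ detached (translate x) c.
Hypothesis b12 : homeo_pow hb 12 <> homeo_one T.

Lemma dom_t : dom t.
Proof. by split => //; exact/commutesP. Qed.

Lemma dom_pow n : dom (homeo_pow t n).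
Proof. by elim: n => [|n IH]; [exact: dom_one|exact: dom_mul dom_t IH]. Qed.

Lemma hb_hr z : supp hb z -> ~ supp (homeo_pow r 12) z.
Proof. exact: (detached_disjoint haus moving br). Qed.

Lemma hq_hb z : supp hb z -> hq z = hb z.
Proof. by move=> bz; rewrite homeo_mulE (notsupp (hb_hr bz)). Qed.

Lemma hq_translate x z : dom x -> supp (translate x) z -> hq z = translate x z.
Proof.
move=> [_ /commutesP xq] /supp_conj bz.
by rewrite hconjE -(hq_hb bz) xq homeoVK.
Qed.

Lemma hq_supp_translate x z : dom x -> supp (translate x) z -> supp (translate x) (hq z).
Proof. by move=> xD xz; rewrite (hq_translate xD xz); apply: supp_image. Qed.

Lemma hqV_supp_translate x z : dom x -> supp (translate x) z -> supp (translate x) (hq^V z).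
Proof.
move=> xD xz; set u := (translate x)^V z.
have xu : supp (translate x) u.
  by apply: supp_V; apply: supp_image; apply: supp_V; rewrite homeo_invK.
have <- : u = hq^V z; last by [].
by apply: (homeo_inj (f := hq)); rewrite homeoVK (hq_translate xD xu) homeoVK.
Qed.

(** Conjugation by [y] reduces this to the translate by [y^V ** x] against [hb] itself. Detachment
    from [c] gives disjointness from its twelfth power, which is [hb]. *)
Lemma translate_disjoint x y : dom x -> dom y ->
  translate x = translate y \/ disjoint_supp (translate x) (translate y).
Proof.
move=> xD yD; case: (disj (dom_mul (dom_inv yD) xD)) => [E|O]; [left|right].
  apply: (@hconj_inj _ y^V); rewrite -!translate_mul E.
  by rewrite homeo_mulV /translate hconj1.
move=> z xz /supp_conj yz; apply: (detached_disjoint haus moving O _ yz).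
by rewrite translate_mul; apply/supp_conj; rewrite homeo_invK homeoVK.
Qed.

Lemma supp_translate_open x : open (supp (translate x)).
Proof. exact: supp_open. Qed.

(** Conjugation by [x] fixes [hq], so it carries the factorization of [hq] to one whose first factor
    is the translate by [x]. *)
Lemma hq_split x z : dom x -> supp hq z ->
  supp (translate x) z \/ supp (hconj x (homeo_pow r 12)) z.
Proof.
move=> [_ xq] qz; apply: contrapT => H; apply: qz.
have /notsupp H1 : ~ supp hb (x^V z) by move=> ?; apply: H; left; apply/supp_conj.
have /notsupp H2 : ~ supp (homeo_pow r 12) (x^V z) by move=> ?; apply: H; right; apply/supp_conj.
by apply: notsupp; rewrite (supp_commutes _ (commutesV xq)) /supp /= homeo_mulE H2 H1.
Qed.

Section Patch.
Variable A : homeo T -> Prop.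

Let U : set T := [set z | exists x, [/\ dom x, A x & supp (translate x) z]].

Lemma patch_open : open U.
Proof.
rewrite openE => z [x [xD Ax xz]].
apply: filterS (open_nbhs_nbhs (conj (@supp_translate_open x) xz)) => u xu.
by exists x.
Qed.

(** A connected neighbourhood inside the support of [hq] is covered by two disjoint open sets, the
    supports of the translate by [x] and of the conjugate of r^12 by [x]. If it met the first, it
    would lie in it. So [U] is relatively clopen in the support of [hq], however many translates it
    joins. *)
Lemma patch_compl_open : open (supp hq `\` U).
Proof.
rewrite openE => z [qz Uz]; have [W [oW Wz Wq cW]] := lconn (supp_open haus hq) qz.
apply: filterS (open_nbhs_nbhs (conj oW Wz)) => u Wu; split; first exact: Wq.
move=> [x [xD Ax xu]]; apply: Uz; exists x; split => //.
apply: (connected_sub_open cW (supp_open haus (translate x))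
  (supp_open haus (hconj x (homeo_pow r 12)))) => //.
- by move=> v /Wq; apply: hq_split.
- by move=> v /supp_conj/hb_hr H /supp_conj.
- by exists u.
Qed.

(** Where [g] fixes a point, both branches have the same value and are continuous, so accumulation
    of translates does no harm. The general [g] covers both [hq] and its inverse. *)
Lemma patch_continuous g : (forall z, supp g z <-> supp hq z) ->
  continuous (fun z => if `[<U z>] then g z else z).
Proof.
move=> gq z; case: (asboolP (U z)) => Uz.
  rewrite /continuous_at asboolT //; apply: cvg_trans (@homeo_continuous _ g z).
  apply: near_eq_cvg.
  apply: filterS (open_nbhs_nbhs (conj patch_open Uz)) => u Uu.
  by rewrite asboolT.
rewrite /continuous_at asboolF //; have [gz|/notsupp gz] := pselect (supp g z).
  apply: (@cvg_trans _ (id @ z)); last exact: cvg_id.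
  apply: near_eq_cvg.
  have zU : (supp hq `\` U) z by split => //; apply/gq.
  apply: filterS (open_nbhs_nbhs (conj patch_compl_open zU)) => u [_ Uu].
  by rewrite asboolF.
move=> V Vz; have Vg : nbhs z (g @^-1` V) by apply: homeo_continuous; rewrite gz.
by apply: filterS2 Vz Vg => u Vu gVu /=; case: ifP.
Qed.

Lemma patch_exists : exists y, (forall z, U z -> y z = hq z) /\ (forall z, ~ U z -> y z = z).
Proof.
pose p g z := if `[<U z>] then g z else z : T.
have qU z : U z -> U (hq z).
  by move=> [x [xD Ax xz]]; exists x; split => //; exact: hq_supp_translate.
have qVU z : U z -> U (hq^V z).
  by move=> [x [xD Ax xz]]; exists x; split => //; exact: hqV_supp_translate.
have H : is_homeo (p hq) (p hq^V).
  split.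
  - move=> z; rewrite /p; case: (asboolP (U z)) => Uz; last by rewrite asboolF.
    by rewrite asboolT ?homeoK //; apply: qU.
  - move=> z; rewrite /p; case: (asboolP (U z)) => Uz; last by rewrite asboolF.
    by rewrite asboolT ?homeoVK //; apply: qVU.
  - exact: patch_continuous.
  - apply: patch_continuous => z; split; first exact: supp_V.
    by rewrite -{1}(homeo_invK hq) => /supp_V.
exists (mk_homeo H); split => z Uz; rewrite /homeo_fun /= /p.
  by rewrite asboolT.
by rewrite asboolF.
Qed.

Lemma member_patch : (forall x x', A x -> translate x = translate x' -> A x') ->
  exists y, forall x, dom x -> member x y <-> A x.
Proof.
move=> Ainv; have [y [yU yn]] := patch_exists; exists y => x xD; split.
  move=> xy; apply: contrapT => Ax; apply: xy.
  apply: disjoint_detached => // z xz yz.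
  have [x' [x'D Ax' x'z]] : U z by apply: contrapT => /yn.
  have [E|H] := translate_disjoint x'D xD; first exact: Ax (Ainv _ _ Ax' E).
  exact: H x'z xz.
(* Detachment would make the twelfth power of [y] trivial on the support of this translate. But [y]
   acts there as the translate, whose twelfth power is nontrivial by [b12]. *)
move=> Ax /(detached_disjoint haus moving) xy.
have [z bz] := nontrivial_supp b12.
have E n u : supp (translate x) u ->
    iter n y u = iter n (translate x) u /\ supp (translate x) (iter n y u).
  move=> xu; elim: n => //= n [IH1 IH2]; rewrite yU; last by exists x.
  rewrite (hq_translate xD IH2); split; last exact: supp_image.
  by rewrite IH1.
have xz : supp (homeo_pow (translate x) 12) (x z).
  by rewrite homeo_pow_conj; apply/supp_conj; rewrite homeoK.
have xz' := supp_iter xz.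
by apply: (xy (x z)) => // Ey; apply: xz; rewrite homeo_powE -(E 12 _ xz').1 -homeo_powE.
Qed.

End Patch.

Lemma member_patch_pow (X : nat -> Prop) : exists y, forall x, dom x ->
  member x y <-> exists n, X n /\ translate x = translate (homeo_pow t n).
Proof.
apply: (@member_patch (fun x => exists n, X n /\ translate x = translate (homeo_pow t n))).
by move=> x x' [n [Xn xn]] xx'; exists n; rewrite -xx'.
Qed.

(** The inductive set of all translates by powers of [t] is itself coded by some [y], so nonstandard
    elements are excluded. Nothing here says yet that different powers give different translates. *)
Lemma naturalP x : natural x <-> exists n, represents x n.
Proof.
split=> [[xD H]|[n [xD xn]]].
  have [y yP] := member_patch_pow setT.
  have [n [_ xn]] : exists n, setT n /\ translate x = translate (homeo_pow t n).
    apply/(yP x xD)/H; first by apply/(yP _ dom_one); exists 0%N.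
    move=> h hD /(yP _ hD) [n [_ hn]]; apply/(yP _ (dom_mul dom_t hD)).
    by exists n.+1; rewrite homeo_powS !translate_mul hn.
  by exists n.
split => // y y0 yS; apply: member_eq (esym xn) _.
by elim: n {xn} => // n IH; apply: yS => //; apply: dom_pow.
Qed.

Lemma represents_natural x n : represents x n -> natural x.
Proof. by move=> xn; apply/naturalP; exists n. Qed.

Lemma represents_pow n : represents (homeo_pow t n) n.
Proof. by split => //; exact: dom_pow. Qed.

Lemma represents_mul x y m n :
  represents x m -> represents y n -> represents (x ** y) (m + n).
Proof.
move=> [xD xm] [yD yn]; split; first exact: dom_mul.
(* [x] and [y] need not be powers of [t]; only their translates are known. Moving [x] past t^n lets
   each be replaced in turn. *)
rewrite translate_mul yn -translate_mul (commutes_sym (commutes_pow n (commutes_sym xD.1))).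
by rewrite translate_mul xm -translate_mul -homeo_powD addnC.
Qed.

Hypothesis aperiodic : forall x, natural x -> translate (t ** x) <> hb.

(** Cancelling the smaller power leaves a positive power of [t] whose translate is [hb], so that
    zero would be a successor. *)
Lemma translate_pow_inj : injective (fun n => translate (homeo_pow t n)).
Proof.
have H m n : (m < n)%N -> translate (homeo_pow t m) <> translate (homeo_pow t n).
  move=> mn; rewrite -(subnKC mn) addSnnS homeo_powD translate_mul => /hconj_inj.
  by move=> /esym; apply: aperiodic; apply: represents_natural (represents_pow _).
move=> m n /= E; by case: (ltngtP m n) => [/H/(_ E)|/H/(_ (esym E))|].
Qed.

Lemma represents_eq x y m n : represents x m -> represents y n ->
  translate x = translate y <-> m = n.
Proof.
move=> [_ xm] [_ yn]; rewrite xm yn; split; first exact: translate_pow_inj.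
by move=> ->.
Qed.

Lemma set_exists (X : nat -> Prop) :
  exists y, forall x n, represents x n -> member x y <-> X n.
Proof.
have [y yP] := member_patch_pow X; exists y => x n xn.
split; first by move=> /(yP x xn.1) [m [Xm]]; rewrite xn.2 => /translate_pow_inj ->.
by move=> Xn; apply/(yP x xn.1); exists n; split => //; exact: xn.2.
Qed.

End Soundness.
End Interpretation.

(** * Manifolds are locally connected and locally moving *)

Section Bump.
Local Open Scope ring_scope.
Variable R : realType.

Lemma coord_le_norm n (v : 'rV[R]_n) i : `|v ord0 i| <= `|v|.
Proof.
rewrite [leRHS]/Num.norm /= mx_normrE; apply/bigmax_geP; right => /=.
by exists (ord0, i).
Qed.

Lemma norm_const_mx n (a : R) : `|const_mx a : 'rV[R]_n| <= `|a|.
Proof.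
rewrite [leLHS]/Num.norm /= mx_normrE; apply/bigmax_leP; split => // i _.
by rewrite mxE.
Qed.

(** As factors on the radius, these two act on u = r / s in [0, 1] as u / (2 - u) and its inverse 2u
    / (1 + u), which fix 0 and 1. The minimum makes both factors 1 beyond radius [s]. *)
Definition contracting (s r : R) := (2 - Num.min (r / s) 1)^-1.
Definition expanding (s r : R) := 2 / (1 + Num.min (r / s) 1).

Variables (n : nat) (s : R).
Hypothesis s0 : 0 < s.
Implicit Types (p v : 'rV[R]_n).

Definition radial (k : R -> R) p v := p + k `|v - p| *: (v - p).

Lemma contracting_ge0 r : 0 <= contracting s r.
Proof. by rewrite invr_ge0 subr_ge0 ge_min; apply/orP; right; lra. Qed.

Lemma expanding_ge0 r : 0 <= r -> 0 <= expanding s r.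
Proof.
move=> r0; rewrite divr_ge0 // addr_ge0 // le_min ler01 andbT divr_ge0 //; exact: ltW.
Qed.

Lemma contractingK r : 0 <= r -> expanding s (contracting s r * r) * contracting s r = 1.
Proof.
rewrite /expanding /contracting -(mulrA _ r) => r0; set u := r / s.
have u0 : 0 <= u by rewrite divr_ge0 // ltW.
move: u u0 => u u0.
case: (leP u 1) => u1.
  have H : (2 - u)^-1 * u <= 1 by rewrite mulrC ler_pdivrMr; lra.
  rewrite min_l //; field; apply/andP; split; lra.
have -> : (2 - 1)^-1 = 1 :> R by field.
by rewrite mul1r min_r ?(ltW u1) //; field.
Qed.

Lemma expandingK r : 0 <= r -> contracting s (expanding s r * r) * expanding s r = 1.
Proof.
rewrite /expanding /contracting -(mulrA _ r) => r0; set u := r / s.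
have u0 : 0 <= u by rewrite divr_ge0 // ltW.
move: u u0 => u u0.
case: (leP u 1) => u1.
  have H : 2 / (1 + u) * u <= 1 by rewrite mulrAC ler_pdivrMr; lra.
  rewrite min_l //; field; apply/andP; split; lra.
have -> : 2 / (1 + 1) = 1 :> R by field.
by rewrite mul1r min_r ?(ltW u1) //; field.
Qed.

Lemma min_continuous (a : R) : continuous (fun r : R => Num.min (r / s) a).
Proof.
move=> r; have H : {for r, continuous (fun r : R => r / s)}.
  by apply: cvgMr_tmp; apply: cvg_id.
exact: (continuous_min H (cvg_cst a)).
Qed.

Lemma contracting_continuous : continuous (contracting s).
Proof.
move=> r; apply: cvgV.
  by apply: lt0r_neq0; rewrite subr_gt0 gt_min; apply/orP; right; lra.
by apply: cvgB; [apply: cvg_cst|exact: min_continuous].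
Qed.

Lemma expanding_continuous r : 0 <= r -> {for r, continuous (expanding s)}.
Proof.
move=> r0; apply: cvgM; first apply: cvg_cst.
apply: cvgV; last by apply: cvgD; [apply: cvg_cst|exact: min_continuous].
apply: lt0r_neq0; have : 0 <= Num.min (r / s) 1 by rewrite le_min ler01 andbT divr_ge0 // ltW.
lra.
Qed.

Lemma radial_continuous (k : R -> R) p : (forall r : R, 0 <= r -> {for r, continuous k}) ->
  continuous (radial k p).
Proof.
move=> kc v.
have vp : w - p @[w --> v] --> v - p.
  exact: (@cvgB R 'rV[R]_n 'rV[R]_n (nbhs v) _ id (fun=> p) v p cvg_id (cvg_cst _)).
have kv : k `|w - p| @[w --> v] --> k `|v - p|.
  have nv : `|w - p| @[w --> v] --> `|v - p| by exact: cvg_norm vp.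
  exact: (@continuous_cvg _ _ _ (nbhs v) _ (fun w => `|w - p|) k _ (kc _ (normr_ge0 _)) nv).
have kvp : k `|w - p| *: (w - p) @[w --> v] --> k `|v - p| *: (v - p) by exact: cvgZ kv vp.
exact: (@cvgD R 'rV[R]_n 'rV[R]_n (nbhs v) _ (fun=> p) _ p _ (cvg_cst p) kvp).
Qed.

Lemma radial_dist k p v : (forall r, 0 <= r -> 0 <= k r) ->
  `|radial k p v - p| = k `|v - p| * `|v - p|.
Proof. by move=> k0; rewrite /radial addrC addKr normrZ ger0_norm // k0. Qed.

Lemma radialK k k' p : (forall r, 0 <= r -> 0 <= k r) ->
  (forall r, 0 <= r -> k' (k r * r) * k r = 1) -> cancel (radial k p) (radial k' p).
Proof.
move=> k0 kk v; rewrite [LHS]/radial (radial_dist p v k0) /radial.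
by rewrite [p + _ - p]addrC addKr scalerA kk // scale1r addrC subrK.
Qed.

Lemma contracting_far p v : s <= `|v - p| -> radial (contracting s) p v = v.
Proof.
move=> sv; rewrite /radial /contracting min_r; last by rewrite ler_pdivlMr // mul1r.
by rewrite (_ : 2 - 1 = 1) ?invr1 ?scale1r ?(addrC p) ?subrK //; ring.
Qed.

Lemma expanding_far p v : s <= `|v - p| -> radial (expanding s) p v = v.
Proof.
move=> sv; rewrite /radial /expanding min_r; last by rewrite ler_pdivlMr // mul1r.
by rewrite (_ : 2 / (1 + 1) = 1) ?scale1r ?(addrC p) ?subrK //; field.
Qed.

Lemma contracting_moves p v : 0 < `|v - p| < s -> radial (contracting s) p v <> v.
Proof.
move=> /andP[v0 vs] E; have := radial_dist p v (fun r _ => contracting_ge0 r).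
rewrite E => /esym H; have : contracting s `|v - p| = 1.
  by apply: (mulIf (lt0r_neq0 v0)); rewrite H mul1r.
rewrite /contracting => /(congr1 (fun a => a^-1)); rewrite invrK invr1.
have H1 : `|v - p| / s < 1 by rewrite ltr_pdivrMr // mul1r.
by rewrite min_l ?ltW //; lra.
Qed.

End Bump.

Section Manifold.
Local Open Scope ring_scope.
Notation R := Rdefinitions.R.
Variable T : topologicalType.

(** [g] is continuous only relative to [B], since [B] is not open when it reaches the boundary of
    the half space. *)
Record half_ball_chart (m : nat) (V O : set T) (B : set 'rV[R]_m.+1)
    (phi : T -> 'rV[R]_m.+1) (g : 'rV[R]_m.+1 -> T) : Prop := HalfBallChart {
  hbc_open : open O;
  hbc_sub : O `<=` V;
  hbc_to : forall y, O y -> B (phi y);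
  hbc_from : forall v, B v -> O (g v);
  hbc_phiK : forall y, O y -> g (phi y) = y;
  hbc_gK : forall v, B v -> phi (g v) = v;
  hbc_phi : forall y, O y -> {for y, continuous phi};
  hbc_g : {within B, continuous g} }.

Lemma half_ball_chart_exists (V : set T) (x : T) :
  compact_manifold T -> open V -> V x ->
  exists (m : nat) (p : 'rV[R]_m.+1) (e : R) O phi g,
    [/\ 0 < e, @halfspace m p, O x &
        half_ball_chart V O ([set v | `|v - p| < e] `&` @halfspace m) phi g].
Proof.
move=> [_ _ _ _ [m /(_ x) [U [W [phi [oU Ux oW]]]]]].
move=> [g [UW WU phiK gK [phic gc]]] oV Vx; exists m, (phi x).
have phic' y : U y -> {for y, continuous phi}.
  by move=> Uy; move: phic; rewrite continuous_open_subspace // => H; apply: H; apply: mem_set.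
have [Wx Hx] := UW _ Ux.
have : nbhs (phi x) [set v | W v /\ (halfspace v -> V (g v))].
  have gx : g @ within (W `&` @halfspace m) (nbhs (phi x)) --> g (phi x).
    by move/subspace_continuousP: gc; apply.
  have Vg : nbhs (g (phi x)) V by rewrite phiK //; apply: open_nbhs_nbhs.
  have := gx _ Vg; rewrite /= /within /= => H.
  have NW : nbhs (phi x) W by apply: open_nbhs_nbhs.
  by apply: filterS2 NW H => v Wv Hv; split => // hv; apply: Hv.
rewrite -nbhs_nbhs_norm => -[e e0 He].
set N := [set v | `|v - phi x| < e].
have NW v : N v -> W v /\ (halfspace v -> V (g v)).
  by move=> Nv; apply: He; rewrite /= distrC.
exists e, (U `&` phi @^-1` N), phi, g; split => //.
  by split => //; rewrite /N /= subrr normr0.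
split.
- rewrite openE => y [Uy Ny].
  have Nphi : nbhs y (phi @^-1` N).
    apply: phic' => //; rewrite -nbhs_nbhs_norm; exists (e - `|phi y - phi x|).
      by rewrite /= subr_gt0.
    move=> v; rewrite /= ltrBrDr => H; apply: le_lt_trans H.
    by rewrite [`|phi y - v|]distrC -[v - phi x](subrKA (phi y)) ler_normD.
  have NU : nbhs y U by apply: open_nbhs_nbhs.
  exact: filterI NU Nphi.
- move=> y [Uy Ny]; have [Wy hy] := UW _ Uy.
  by rewrite -(phiK _ Uy); apply: (NW _ Ny).2.
- by move=> y [Uy Ny]; split => //; exact: (UW _ Uy).2.
- move=> v [Nv hv]; have Wv := (NW _ Nv).1; split; first exact: WU.
  by rewrite /= gK.
- by move=> y [Uy _]; exact: phiK.
- by move=> v [Nv hv]; apply: gK; split => //; exact: (NW _ Nv).1.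
- by move=> y [Uy _]; exact: phic'.
- apply: continuous_subspaceW gc => v [Nv hv]; split => //; exact: (NW _ Nv).1.
Qed.

(** The set is star-shaped about [p], hence a union of segments through [p]. *)
Lemma half_ball_connected m (p : 'rV[R]_m.+1) e : halfspace p ->
  connected ([set v | `|v - p| < e] `&` @halfspace m).
Proof.
move=> hp; set B := _ `&` _.
have segB v s : B v -> `[0, 1]%classic s -> B (p + s *: (v - p)).
  rewrite /= in_itv /= => -[/= ve vh] /andP[s0 s1]; split => /=.
    rewrite addrC addKr normrZ ger0_norm //; apply: le_lt_trans ve.
    by rewrite ler_piMl.
  rewrite /halfspace /= !mxE; move: hp vh; rewrite /halfspace /=; nra.
have -> : B = \bigcup_(v in B) [set p + s *: (v - p) | s in `[0, 1]%classic].
  apply/seteqP; split => [v Bv|_ [v Bv [s s01 <-]]]; last exact: segB.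
  exists v => //; exists 1; first by rewrite /= in_itv /= lexx ler01.
  by rewrite scale1r addrC subrK.
apply: bigcup_connected.
  exists p => v Bv; exists 0; first by rewrite /= in_itv /= lexx ler01.
  by rewrite scale0r addr0.
move=> v Bv; apply: connected_continuous_connected; first exact: segment_connected.
apply: continuous_subspaceT => s.
have sc : r *: (v - p) @[r --> s] --> s *: (v - p) by apply: cvgZr_tmp; exact: cvg_id.
exact: (@cvgD R 'rV[R]_m.+1 _ (nbhs s) _ (fun=> p) _ p _ (cvg_cst p) sc).
Qed.

Lemma manifold_locally_connected : compact_manifold T -> locally_connected T.
Proof.
move=> M z V oV Vz.
have [m [p [e [ O [phi [g [e0 hp Oz [oO OV to from phiK gK phic gc]]]]]]]] :=
  half_ball_chart_exists M oV Vz.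
exists O; split => //.
have -> : O = g @` ([set v | `|v - p| < e] `&` @halfspace m).
  apply/seteqP; split => [y Oy|_ [v Bv <-]]; last exact: from.
  by exists (phi y); [exact: to|exact: phiK].
by apply: connected_continuous_connected gc; apply: half_ball_connected.
Qed.

(** * Transport of homeomorphisms from a half ball to the manifold *)

Section Lift.
Variables (m : nat) (V O : set T) (B : set 'rV[R]_m.+1).
Variables (phi : T -> 'rV[R]_m.+1) (g : 'rV[R]_m.+1 -> T).
Hypothesis chart : half_ball_chart V O B phi g.
Hypothesis haus : hausdorff_space T.
Variable K : set 'rV[R]_m.+1.
Hypothesis K_compact : compact K.
Hypothesis KB : K `<=` B.

Definition lift_map (beta : 'rV[R]_m.+1 -> 'rV[R]_m.+1) (y : T) : T :=
  if `[<O y>] then g (beta (phi y)) else y.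

Section Continuity.
Variable beta : 'rV[R]_m.+1 -> 'rV[R]_m.+1.
Hypothesis beta_cont : continuous beta.
Hypothesis betaB : forall v, B v -> B (beta v).
Hypothesis betaK : forall v, ~ K v -> beta v = v.

(** The image of [K] is compact, hence closed in the Hausdorff space [T], and the lifted map is the
    identity on its complement. This open set contains every point outside [O]. *)
Lemma lift_map_continuous : continuous (lift_map beta).
Proof.
case: chart => oO OV to from phiK gK phic gc y.
have [Oy|Oy] := pselect (O y).
  have NO : nbhs y O by apply: open_nbhs_nbhs.
  have gy : g @ within B (nbhs (beta (phi y))) --> g (beta (phi y)).
    by move/subspace_continuousP: gc; apply; apply/betaB/to.
  rewrite /continuous_at {2}/lift_map asboolT // => A /gy; rewrite /= /within /= => H.
  have bc : {for y, continuous (beta \o phi)}.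
    by apply: continuous_comp; [exact: phic|exact: beta_cont].
  have := bc _ H; rewrite /= => H'.
  apply: filterS2 NO H' => u Ou; rewrite /= /lift_map asboolT //; apply.
  exact/betaB/to.
have cK : closed (g @` K).
  apply: compact_closed => //; apply: continuous_compact => //.
  exact: continuous_subspaceW gc.
have Ky : (~` (g @` K)) y by move=> [v Kv E]; apply: Oy; rewrite -E; apply/from/KB.
have id_near u : (~` (g @` K)) u -> lift_map beta u = u.
  move=> Ku; rewrite /lift_map; case: asboolP => // Ou.
  rewrite betaK ?phiK // => Kphi; apply: Ku; exists (phi u) => //.
  exact: phiK.
have NK : nbhs y (~` (g @` K)).
  by apply: open_nbhs_nbhs; split => //; exact: closed_openC.
rewrite /continuous_at id_near // => A NA.
apply: filterS2 NK NA => u Ku Au.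
by rewrite /= id_near.
Qed.

End Continuity.

Lemma lift_mapK beta beta' : (forall v, B v -> B (beta v)) ->
  cancel beta beta' -> cancel (lift_map beta) (lift_map beta').
Proof.
case: chart => oO OV to from phiK gK phic gc betaB bK y.
rewrite {2}/lift_map; case: asboolP => Oy; last by rewrite /lift_map asboolF.
have By := betaB _ (to _ Oy).
by rewrite /lift_map asboolT ?gK ?bK ?phiK //; exact: from.
Qed.

End Lift.

Lemma closed_ball_rV_compact m (p : 'rV[R]_m.+1) d : compact [set v | `|v - p| <= d].
Proof.
apply: bounded_closed_compact.
  exists (`|p| + `|d|); split; first exact: num_real.
  move=> M HM v /= vd; rewrite -(subrK p v); apply: le_trans (ler_normD _ _) _.
  have := ler_norm d; lra.
have -> : [set v | `|v - p| <= d] = (fun v => `|v - p|) @^-1` [set r | r <= d] by [].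
apply: preimage_closed; last exact: closed_le.
move=> v _.
have vp : w - p @[w --> v] --> v - p.
  exact: (@cvgB R 'rV[R]_m.+1 'rV[R]_m.+1 (nbhs v) _ id (fun=> p) v p cvg_id (cvg_cst _)).
exact: cvg_norm vp.
Qed.

Lemma manifold_locally_moving : compact_manifold T -> locally_moving T.
Proof.
move=> M V oV [x Vx].
have [m [p [e [ O [phi [g [e0 hp Ox chart]]]]]]] := half_ball_chart_exists M oV Vx.
have [oO OV to from phiK gK phic gc] := chart.
set B := _ `&` _ in chart to from gK gc.
(* Shifting every coordinate by e/2 moves the centre away from the boundary. In the maximum norm the
   ball of radius e/4 about it stays within 3e/4 of [p], and its first coordinates are at least
   e/4. *)
pose p' : 'rV[R]_m.+1 := p + const_mx (e / 2).
pose d := e / 4; have d0 : 0 < d by rewrite /d; lra.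
pose K := [set v : 'rV[R]_m.+1 | `|v - p'| <= d].
have KB : K `<=` B.
  move=> v; rewrite /K /= => vd; split => /=.
    have -> : v - p = (v - p') + const_mx (e / 2) by rewrite /p' opprD addrA subrK.
    apply: le_lt_trans (ler_normD _ _) _.
    have := @norm_const_mx R m.+1 (e / 2); rewrite (@ger0_norm _ (e / 2)); last lra.
    by move: vd; rewrite /d; lra.
  have := le_trans (coord_le_norm (v - p') ord0) vd; rewrite /p' !mxE ler_norml.
  move: hp; rewrite /halfspace /= /d => hp /andP[H _]; lra.
have rB k (q : 'rV[R]_m.+1) : (forall v : 'rV[R]_m.+1, d <= `|v - p'| -> radial k p' v = v) ->
    (forall v, K v -> K (radial k p' v)) -> B q -> B (radial k p' q).
  move=> far near Bq; have [Kq|] := pselect (K q); first exact/KB/near.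
  by rewrite /K /= => /negP; rewrite -ltNge => /ltW/far ->.
have far k : (forall v : 'rV[R]_m.+1, d <= `|v - p'| -> radial k p' v = v) ->
    forall v, ~ K v -> radial k p' v = v.
  by move=> H v; rewrite /K /= => /negP; rewrite -ltNge => /ltW/H.
have K1 : forall v, K v -> K (radial (contracting d) p' v).
  move=> v; rewrite /K /= radial_dist => [vd|r _]; last exact: contracting_ge0.
  apply: le_trans vd; rewrite ler_piMl // /contracting.
  have : Num.min (`|v - p'| / d) 1 <= 1 by rewrite ge_min lexx orbT.
  by move=> H; rewrite invf_le1; lra.
have e_ge0 (r : R) : 0 <= r -> 0 <= expanding d r by exact: expanding_ge0.
have K2 : forall v, K v -> K (radial (expanding d) p' v).
  move=> v; rewrite /K /= radial_dist // => vd.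
  have u0 : 0 <= `|v - p'| / d by rewrite divr_ge0 // ltW.
  have u1 : `|v - p'| / d <= 1 by rewrite ler_pdivrMr // mul1r.
  have E : `|v - p'| = `|v - p'| / d * d by rewrite divfK // lt0r_neq0.
  rewrite /expanding min_l // [X in _ * X <= _]E; move: (_ / d) u0 u1 => u u0 u1.
  have H : 2 / (1 + u) * u <= 1 by rewrite mulrAC ler_pdivrMr; lra.
  by rewrite mulrA; apply: le_trans (ler_wpM2r (ltW d0) H) _; rewrite mul1r.
pose b1 := radial (contracting d) p'; pose b2 := radial (expanding d) p'.
have b1B v : B v -> B (b1 v).
  by move=> Bv; apply: rB Bv => //; move=> w; apply: contracting_far.
have b2B v : B v -> B (b2 v).
  by move=> Bv; apply: rB Bv => //; move=> w; apply: expanding_far.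
have H : is_homeo (lift_map O phi g b1) (lift_map O phi g b2).
  have haus : hausdorff_space T by case: M.
  have cK : compact K by apply: closed_ball_rV_compact.
  split.
  - apply: (lift_mapK chart) => //; apply: radialK => r r0; first exact: contracting_ge0.
    exact: contractingK.
  - apply: (lift_mapK chart) => //; apply: radialK => // r r0.
    exact: expandingK.
  - apply: (lift_map_continuous chart haus cK KB) => //.
      by apply: radial_continuous => r _; exact: contracting_continuous.
    by apply: far => v; apply: contracting_far.
  - apply: (lift_map_continuous chart haus cK KB) => //.
      by apply: radial_continuous => r r0; exact: expanding_continuous.
    by apply: far => v; apply: expanding_far.
exists (mk_homeo H); split.
  pose v : 'rV[R]_m.+1 := p' + const_mx (d / 2).
  have vE : `|v - p'| = d / 2.
    rewrite /v addrC addKr; apply: le_anti; apply/andP; split.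
      by apply: le_trans (norm_const_mx _ _) _; rewrite ger0_norm; lra.
    by have := coord_le_norm (const_mx (d / 2) : 'rV[R]_m.+1) ord0; rewrite mxE ger0_norm; lra.
  have Bv : B v by apply: KB; rewrite /K /= vE; lra.
  exists (g v); rewrite /supp /= /homeo_fun /= /lift_map asboolT; last exact: from.
  rewrite gK // => /(congr1 phi); rewrite !gK //; last exact: b1B.
  by apply: (contracting_moves d0 (p := p') (v := v)); rewrite vE; lra.
move=> y; rewrite /supp /= /homeo_fun /= /lift_map; case: asboolP => // Oy _.
exact: OV.
Qed.

End Manifold.

(** * The extended real line *)

Section OrderIsomorphism.
Local Open Scope order_scope.
Context {d : Order.disp_t} {X : orderTopologicalType d}.
Variables f g : X -> X.
Hypothesis f_homo : {homo f : x y / x <= y}.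
Hypothesis g_homo : {homo g : x y / x <= y}.
Hypothesis fK : cancel f g.
Hypothesis gK : cancel g f.

Lemma order_iso_le x y : (f x <= y) = (x <= g y).
Proof. by apply/idP/idP => [/g_homo|/f_homo]; rewrite ?fK ?gK. Qed.

Lemma order_iso_ge x y : (y <= f x) = (g y <= x).
Proof. by apply/idP/idP => [/g_homo|/f_homo]; rewrite ?fK ?gK. Qed.

(** Order isomorphisms pull open intervals back to open intervals. On the extended line this treats
    the infinite points together with the finite ones. *)
Lemma order_iso_continuous : continuous f.
Proof.
move=> x A; rewrite /= itv_nbhsE => -[i [oi xi] iA].
rewrite /nbhs /= -/(nbhs x) itv_nbhsE /=.
suff [j [oj jE]] : exists j, itv_open_ends j /\ forall z, (f z \in i) = (z \in j).
  by exists j; [rewrite -jE|move=> z /=; rewrite -jE => /iA].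
case: i oi xi {iA} => [[[]a|[]]] [[]b|[]] //= oi xi.
- exists `]g a, g b[; split => // z.
  by rewrite !in_itv /= !ltNge order_iso_le order_iso_ge.
- exists `]g a, +oo[; split => // z.
  by rewrite !in_itv /= !ltNge order_iso_le.
- exists `]-oo, g b[; split => // z.
  by rewrite !in_itv /= !ltNge order_iso_ge.
- by exists `]-oo, +oo[.
Qed.

End OrderIsomorphism.

Section Ereal.
Local Open Scope ring_scope.
Variable R : realType.
Implicit Types x y z : \bar R.

Lemma contract_continuous : continuous (@contract R).
Proof.
move=> x; apply/cvgrPdist_lt => e e0.
have H := @nbhsx_ballx R (\bar R) x e e0.
exact: filterS H.
Qed.

Lemma expand_continuous (A : set R) : A `<=` `[-1, 1]%classic ->
  {within A, continuous (@expand R)}.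
Proof.
move=> A1; apply/subspace_continuousP => r Ar V /nbhs_ballP [e e0 eV].
apply/nbhs_ballP; exists e => // s rs As; apply: eV.
have H u : A u -> contract (expand u) = u.
  by move=> /A1; rewrite /= in_itv /= => H; apply: expandK; rewrite inE ler_norml.
by rewrite /ball /= /ereal_ball !H.
Qed.

Lemma ereal_expand_image : [set: \bar R] = @expand R @` `[-1, 1]%classic.
Proof.
apply/seteqP; split => // x _; exists (contract x); last exact: contractK.
by rewrite /= in_itv /= -ler_norml contract_le1.
Qed.

Lemma ereal_compact : compact [set: \bar R].
Proof.
rewrite ereal_expand_image; apply: continuous_compact; last exact: segment_compact.
exact: expand_continuous.
Qed.

Lemma ereal_connected : connected [set: \bar R].
Proof.
rewrite ereal_expand_image; apply: connected_continuous_connected.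
  exact: segment_connected.
exact: expand_continuous.
Qed.

Lemma rV1E (v : 'rV[R]_1) : const_mx (v ord0 ord0) = v.
Proof. by apply/rowP => i; rewrite mxE; congr (v _ _); rewrite !ord1. Qed.

Lemma const_mx_continuous1 : continuous (fun r : R => const_mx r : 'rV[R]_1).
Proof.
move=> r; apply/cvgrPdist_lt => e e0; apply/nbhs_ballP; exists e => // s /= rs.
apply: le_lt_trans rs; have -> : const_mx r - const_mx s = const_mx (r - s) :> 'rV[R]_1.
  by apply/rowP => i; rewrite !mxE.
exact: norm_const_mx.
Qed.

Lemma scale_contract_continuous (s : R) : continuous (fun x => s * contract x).
Proof. by move=> x; apply: cvgMl_tmp; exact: contract_continuous. Qed.

Lemma chart_continuous (s : R) :
  continuous (fun x => const_mx (1 - s * contract x) : 'rV[R]_1).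
Proof.
move=> x.
have H : 1 - s * contract y @[y --> x] --> 1 - s * contract x.
  exact: (@cvgB R R _ (nbhs x) _ (fun=> 1) _ _ _ (cvg_cst _) (@scale_contract_continuous s x)).
exact: (@continuous_cvg _ _ _ (nbhs x) _ (fun y => 1 - s * contract y)
  (fun r : R => const_mx r : 'rV[R]_1) _ (@const_mx_continuous1 _) H).
Qed.

Lemma scale_contract_open (s : R) : open [set x | -1 < s * contract x].
Proof.
have -> : [set x | -1 < s * contract x] = (fun x => s * contract x) @^-1` [set r | -1 < r] by [].
apply: open_comp; last exact: open_gt.
by move=> y _; exact: scale_contract_continuous.
Qed.

Lemma coord_lt_open (a : R) : open [set v : 'rV[R]_1 | v ord0 ord0 < a].
Proof.
have -> : [set v : 'rV[R]_1 | v ord0 ord0 < a] =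
  (fun v : 'rV[R]_1 => v ord0 ord0) @^-1` [set r | r < a] by [].
by apply: open_comp; [move=> v _; exact: coord_continuous|exact: open_lt].
Qed.

Lemma coord_near (v : 'rV[R]_1) (e : R) : 0 < e ->
  nbhs v [set w : 'rV[R]_1 | `|v ord0 ord0 - w ord0 ord0| < e].
Proof.
move=> e0; rewrite -nbhs_nbhs_norm; exists e => // w /= H; apply: le_lt_trans H.
by have := coord_le_norm (v - w) ord0; rewrite !mxE.
Qed.

End Ereal.

Section Line.
Local Open Scope ring_scope.
Notation R := Rdefinitions.R.
Implicit Types x y z : \bar R.

(* The two charts, [s = 1] around +oo and [s = -1] around -oo, overlap in the reals. *)
Lemma ereal_chart (s : R) : s = 1 \/ s = - 1 ->
  homeo_between [set x : \bar R | -1 < s * contract x]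
    ([set v : 'rV[R]_1 | v ord0 ord0 < 2] `&` @halfspace 0)
    (fun x => const_mx (1 - s * contract x)).
Proof.
move=> hs; have ss : s * s = 1 by case: hs => ->; ring.
have ns : `|s| = 1 by case: hs => ->; rewrite ?normrN normr1.
have cle x : s * contract x <= 1.
  by apply: le_trans (ler_norm _) _; rewrite normrM ns mul1r contract_le1.
pose g (v : 'rV[R]_1) := expand (s * (1 - v ord0 ord0)).
have eK (v : 'rV[R]_1) : v ord0 ord0 < 2 -> @halfspace 0 v ->
    contract (g v) = s * (1 - v ord0 ord0).
  rewrite /halfspace /= => v2 v0; apply: expandK.
  by rewrite inE normrM ns mul1r ler_norml; lra.
exists g; split.
- by move=> x /= sx; split; rewrite /halfspace /= !mxE; [lra|have := cle x; lra].
- by move=> v [/= v2 v0]; rewrite eK // mulrA ss; lra.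
- move=> x _; rewrite /g mxE (_ : 1 - (1 - s * contract x) = s * contract x); last by ring.
  by rewrite mulrA ss mul1r contractK.
- by move=> v [/= v2 v0]; rewrite eK // mulrA ss mul1r subKr rV1E.
split.
  exact/continuous_subspaceT/chart_continuous.
apply/subspace_continuousP => v [v2 v0] V /nbhs_ballP [e e0 eV].
apply: filterS (coord_near v e0) => w wv [/= w2 w0]; apply: eV.
rewrite /ball /= /ereal_ball !eK // -mulrBr normrM ns mul1r.
move: wv; by rewrite (_ : 1 - _ - (1 - w ord0 ord0) = - (v ord0 ord0 - w ord0 ord0)) ?normrN //; ring.
Qed.

Lemma ereal_manifold : compact_manifold (\bar R).
Proof.
split.
- exact: ereal_hausdorff.
- exact: compact_second_countable (@ereal_compact R).

- exact: (@ereal_compact R).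
- by split; [exact: (@ereal_connected R)|exists +oo%E].
exists 0%N => x.
have [s hs sx] : exists2 s : R, s = 1 \/ s = - 1 & -1 < s * contract x.
  have := contract_le1 x; rewrite ler_norml => /andP[c1 c2].
  have [c0|c0] := ltP (-1) (contract x).
    by exists 1; [left|rewrite mul1r].
  by exists (-1); [right|rewrite mulN1r; lra].
exists [set x : \bar R | -1 < s * contract x], [set v : 'rV[R]_1 | v ord0 ord0 < 2].
exists (fun x => const_mx (1 - s * contract x)); split => //.
- exact: scale_contract_open.
- exact: coord_lt_open.
- exact: ereal_chart.
Qed.

End Line.

(** * Good parameters on the extended real line *)

Section GoodParams.
Local Open Scope ring_scope.
Notation R := Rdefinitions.R.
Implicit Types (x y z : \bar R) (u v : R).

Lemma er_map_homeo (f g : R -> R) : {homo f : u v / u <= v} -> {homo g : u v / u <= v} ->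
  cancel f g -> cancel g f -> is_homeo (er_map f : \bar R -> \bar R) (er_map g).
Proof.
move=> fh gh fK gK.
have FK : cancel (er_map f : \bar R -> \bar R) (er_map g) by case=> //= u; rewrite fK.
have GK : cancel (er_map g : \bar R -> \bar R) (er_map f) by case=> //= u; rewrite gK.
by split => //; [exact: order_iso_continuous (le_er_map fh) (le_er_map gh) FK GK
                |exact: order_iso_continuous (le_er_map gh) (le_er_map fh) GK FK].
Qed.

(** The profile of the radial contraction on [0, 1]: it fixes the ends and lowers every point
    between them, so none of its positive powers fixes an interior point. *)
Definition unit_map u := u / (2 - u).
Definition unit_map_inv u := 2 * u / (1 + u).

Lemma unit_map_le u v : 0 <= u <= 1 -> 0 <= v <= 1 -> u <= v -> unit_map u <= unit_map v.
Proof.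
move=> u1 v1 uv; rewrite /unit_map ler_pdivrMr; last lra.
by rewrite mulrAC ler_pdivlMr; nra.
Qed.

Lemma unit_map_inv_le u v : 0 <= u <= 1 -> 0 <= v <= 1 -> u <= v ->
  unit_map_inv u <= unit_map_inv v.
Proof.
move=> u1 v1 uv; rewrite /unit_map_inv ler_pdivrMr; last lra.
by rewrite mulrAC ler_pdivlMr; nra.
Qed.

Lemma unit_mapK u : 0 <= u <= 1 -> unit_map_inv (unit_map u) = u.
Proof. by move=> u1; rewrite /unit_map_inv /unit_map; field; apply/andP; split; lra. Qed.

Lemma unit_map_invK u : 0 <= u <= 1 -> unit_map (unit_map_inv u) = u.
Proof. by move=> u1; rewrite /unit_map_inv /unit_map; field; apply/andP; split; lra. Qed.

Lemma unit_map_bounds u : 0 <= u <= 1 -> 0 <= unit_map u <= 1.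
Proof.
by move=> u1; rewrite /unit_map ler_pdivlMr ?ler_pdivrMr; lra.
Qed.

Lemma unit_map_inv_bounds u : 0 <= u <= 1 -> 0 <= unit_map_inv u <= 1.
Proof.
by move=> u1; rewrite /unit_map_inv ler_pdivlMr ?ler_pdivrMr; lra.
Qed.

Lemma unit_map_lt1 u : 0 <= u < 1 -> 0 <= unit_map u < 1.
Proof.
by move=> u1; rewrite /unit_map ler_pdivlMr ?ltr_pdivrMr; lra.
Qed.

Lemma unit_map_inv_lt1 u : 0 <= u < 1 -> 0 <= unit_map_inv u < 1.
Proof.
by move=> u1; rewrite /unit_map_inv ler_pdivlMr ?ltr_pdivrMr; lra.
Qed.

Lemma unit_map_lt u : 0 < u < 1 -> 0 < unit_map u < u.
Proof.
move=> u1; rewrite /unit_map divr_gt0 /= ?ltr_pdivrMr; nra.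
Qed.

Definition on_unit (f : R -> R) u := if (0 <= u) && (u <= 1) then f u else u.

Lemma on_unit_le (f : R -> R) : (forall u, 0 <= u <= 1 -> 0 <= f u <= 1) ->
  (forall u v, 0 <= u <= 1 -> 0 <= v <= 1 -> u <= v -> f u <= f v) ->
  {homo on_unit f : u v / u <= v}.
Proof.
move=> fb fm u v uv; rewrite /on_unit.
case: ifP => u1; case: ifP => v1 //; first exact: fm.
  by have := fb _ u1; move/negbT: v1; rewrite negb_and -!ltNge => /orP[]; lra.
by have := fb _ v1; move/negbT: u1; rewrite negb_and -!ltNge => /orP[]; lra.
Qed.

Lemma on_unitK (f g : R -> R) : (forall u, 0 <= u <= 1 -> 0 <= f u <= 1) ->
  (forall u, 0 <= u <= 1 -> g (f u) = u) -> cancel (on_unit f) (on_unit g).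
Proof.
move=> fb fK u; rewrite {2}/on_unit; case: ifP => u1; rewrite /on_unit ?u1 //.
by rewrite fb // fK.
Qed.

Lemma line_bump_homeo : is_homeo (er_map (on_unit unit_map) : \bar R -> \bar R)
  (er_map (on_unit unit_map_inv)).
Proof.
apply: er_map_homeo.
- exact: on_unit_le unit_map_bounds unit_map_le.
- exact: on_unit_le unit_map_inv_bounds unit_map_inv_le.
- exact: on_unitK unit_map_bounds unit_mapK.
- exact: on_unitK unit_map_inv_bounds unit_map_invK.
Qed.

Lemma line_shift_homeo : is_homeo (er_map (fun u => u + 1) : \bar R -> \bar R)
  (er_map (fun u => u - 1)).
Proof. by apply: er_map_homeo => [u v|u v|u|u]; try lra; ring. Qed.

Definition periodic (f : R -> R) u := (Num.floor u)%:~R + f (u - (Num.floor u)%:~R).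

Lemma frac_bounds u : 0 <= u - (Num.floor u)%:~R < 1.
Proof. by have := Num.Theory.floor_itv u; rewrite intrD; lra. Qed.

Lemma floor_periodic (f : R -> R) u : (forall v, 0 <= v < 1 -> 0 <= f v < 1) ->
  Num.floor (periodic f u) = Num.floor u.
Proof.
move=> fb; apply: floor_def; rewrite /periodic intrD.
by have := fb _ (frac_bounds u); lra.
Qed.

Lemma periodicK (f g : R -> R) : (forall v, 0 <= v < 1 -> 0 <= f v < 1) ->
  (forall v, 0 <= v <= 1 -> g (f v) = v) -> cancel (periodic f) (periodic g).
Proof.
move=> fb fK u; rewrite [LHS]/periodic (floor_periodic _ fb) /periodic.
rewrite (addrC (_%:~R) (f _)) addrK fK; first by rewrite addrC subrK.
by have := frac_bounds u; lra.
Qed.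

Lemma periodic_le (f : R -> R) : (forall v, 0 <= v < 1 -> 0 <= f v < 1) ->
  (forall u v, 0 <= u <= 1 -> 0 <= v <= 1 -> u <= v -> f u <= f v) ->
  {homo periodic f : u v / u <= v}.
Proof.
move=> fb fm u v uv; rewrite /periodic.
have uf := frac_bounds u; have vf := frac_bounds v.
have : (Num.floor u <= Num.floor v)%R by apply: Num.Theory.le_floor.
rewrite le_eqVlt => /orP[/eqP E|].
  by rewrite -E in vf *; rewrite lerD2l; apply: fm; lra.
rewrite -lezD1 -(ler_int R) intrD => H.
by have := fb _ uf; have := fb _ vf; lra.
Qed.

Lemma line_periodic_homeo : is_homeo (er_map (periodic unit_map) : \bar R -> \bar R)
  (er_map (periodic unit_map_inv)).
Proof.
apply: er_map_homeo.
- exact: periodic_le unit_map_lt1 unit_map_le.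
- exact: periodic_le unit_map_inv_lt1 unit_map_inv_le.
- exact: periodicK unit_map_lt1 unit_mapK.
- exact: periodicK unit_map_inv_lt1 unit_map_invK.
Qed.

Definition line_t : homeo (\bar R) := mk_homeo line_shift_homeo.
Definition line_c : homeo (\bar R) := mk_homeo line_bump_homeo.
Definition line_q : homeo (\bar R) := mk_homeo line_periodic_homeo.
(** This is [line_q] with its motion inside (0, 1) removed: there [line_q] agrees with [line_c], and
    elsewhere [line_c] is the identity. *)
Definition line_r : homeo (\bar R) := line_c^V ** line_q.

Definition unit_itv : set (\bar R) := [set u%:E | u in `]0, 1[%classic].

Lemma unit_itvP u : unit_itv u%:E <-> 0 < u < 1.
Proof.
split; first by move=> [v /=]; rewrite in_itv /= => H [<-].
by move=> u1; exists u => //=; rewrite in_itv.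
Qed.

Lemma unit_itv_real x : unit_itv x -> exists2 u, 0 < u < 1 & x = u%:E.
Proof. by move=> [u /=]; rewrite in_itv /= => u1 <-; exists u. Qed.

Lemma line_c_unit u : 0 < u < 1 -> line_c u%:E = (unit_map u)%:E.
Proof. by move=> u1; rewrite /homeo_fun /= /on_unit ifT //; lra. Qed.

Lemma line_q_unit u : 0 <= u < 1 -> line_q u%:E = (unit_map u)%:E.
Proof.
move=> u1; rewrite /homeo_fun /= /periodic (_ : Num.floor u = 0).
  by rewrite add0r subr0.
by apply: floor_def; rewrite add0r; lra.
Qed.

Lemma line_c_supp x : supp line_c x -> unit_itv x.
Proof.
case: x => [u||] // H; apply/unit_itvP; apply/negP => u1; apply: H.
rewrite /homeo_fun /= /on_unit; case: ifP => // u2; congr _%:E.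
by have [->|->] : u = 0 \/ u = 1 by [have [|] := eqVneq u 0; [left|right; lra]]; rewrite /unit_map; field.
Qed.

Lemma unit_decreasing_pow (h : homeo (\bar R)) n x :
  (forall z, unit_itv z -> unit_itv (h z) /\ (h z < z)%E) ->
  unit_itv x -> unit_itv (homeo_pow h n.+1 x) /\ (homeo_pow h n.+1 x < x)%E.
Proof.
move=> H Ix; elim: n => [|n [I1 L1]]; first by rewrite homeo_powE /=; exact: H.
rewrite homeo_powE iterS -homeo_powE; have [I2 L2] := H _ I1.
by split => //; exact: lt_trans L1.
Qed.

Lemma line_c_decreasing x : unit_itv x -> unit_itv (line_c x) /\ (line_c x < x)%E.
Proof.
move=> /unit_itv_real [u u1 ->]; rewrite line_c_unit //.
have := unit_map_lt u1 => u2; split; first by apply/unit_itvP; lra.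
by rewrite lte_fin; lra.
Qed.

Lemma line_hb_decreasing x : unit_itv x ->
  unit_itv (hb line_c x) /\ (hb line_c x < x)%E.
Proof. exact: unit_decreasing_pow line_c_decreasing. Qed.

Lemma line_hb_supp x : supp (hb line_c) x <-> unit_itv x.
Proof.
split; first by move=> /supp_iter/line_c_supp.
by move=> /line_hb_decreasing [_ + E]; rewrite E ltxx.
Qed.

Lemma line_r_unit x : unit_itv x -> line_r x = x.
Proof.
move=> /unit_itv_real [u u1 ->]; rewrite homeo_mulE line_q_unit; last lra.
by rewrite -line_c_unit // homeoK.
Qed.

Lemma line_q_factor : line_c ** line_r = line_q.
Proof. by apply: homeo_ext => x; rewrite !homeo_mulE homeoVK. Qed.

Lemma homeo_pow_mul (T : topologicalType) (f g : homeo T) n : commutes f g ->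
  homeo_pow (f ** g) n = homeo_pow f n ** homeo_pow g n.
Proof.
move=> fg; apply: homeo_ext => z; rewrite homeo_mulE; elim: n => //= n IH.
rewrite !homeo_powS !homeo_mulE IH; congr (f _).
by have /commutesP -> := commutes_sym (commutes_pow n fg).
Qed.

Lemma line_hq : hq line_c line_r = homeo_pow line_q 12.
Proof.
rewrite -line_q_factor homeo_pow_mul //; apply: disjoint_commutes => z /line_c_supp/line_r_unit.
by move=> E; apply.
Qed.

Lemma line_t_q : commutes line_t line_q.
Proof.
apply/commutesP; case=> // u; rewrite /homeo_fun /=; congr _%:E.
have E : Num.floor (u + 1) = Num.floor u + 1.
  apply: floor_def; have := Num.Theory.floor_itv u; rewrite !intrD; lra.
rewrite /periodic E intrD (_ : u + 1 - _ = u - (Num.floor u)%:~R); ring.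
Qed.

Lemma line_q_0 : line_q 0%:E = 0%:E.
Proof. by rewrite line_q_unit /unit_map ?mul0r //; lra. Qed.

Lemma line_q_1 : line_q 1%:E = 1%:E.
Proof.
have -> : 1%:E = line_t 0%:E by rewrite /homeo_fun /= add0r.
by move/commutesP: line_t_q => <-; rewrite line_q_0.
Qed.

Lemma unit_itvE : unit_itv = [set x | (0 < x)%E] `&` [set x | (x < 1)%E].
Proof.
apply/seteqP; split => [_ [u /= + <-]|]; first by rewrite in_itv /= !lte_fin => /andP.
by case=> [u||] //= []; rewrite ?lte_fin // => u0 u1; apply/unit_itvP; rewrite u0.
Qed.

Lemma unit_itv_open : open unit_itv.
Proof. by rewrite unit_itvE; apply: openI; [exact: open_ereal_gt_ereal|exact: open_ereal_lt_ereal]. Qed.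

Lemma unit_itv_connected : connected unit_itv.
Proof.
apply: connected_continuous_connected.
  exact/connected_intervalP/interval_is_interval.
by apply: continuous_subspaceT => u A /nbhs_EFin.
Qed.

Lemma connected_in_unit (S : set (\bar R)) : connected S -> ~ S 0%:E -> ~ S 1%:E ->
  S `&` unit_itv !=set0 -> S `<=` unit_itv.
Proof.
move=> cS S0 S1; apply: (connected_sub_open cS unit_itv_open
   (B := [set x | (x < 0)%E] `|` [set x | (1 < x)%E])).
- by apply: openU; [exact: open_ereal_lt_ereal|exact: open_ereal_gt_ereal].
- move=> x Sx; rewrite unit_itvE; case: (ltgtP 0%E x) => [x0|x0|E]; last by case: S0; move: Sx; rewrite -E.
    case: (ltgtP x 1%E) => [x1|x1|E]; last by case: S1; move: Sx; rewrite E.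
      by left.
    by right; right.
  by right; left.
- move=> x; rewrite unit_itvE => -[/= x0 x1] [] /=.
    by move=> /(lt_trans x0); rewrite ltxx.
  by move=> /(lt_trans x1); rewrite ltxx.
Qed.

Lemma line_hq_unit x : unit_itv x -> hq line_c line_r x = hb line_c x.
Proof.
move=> Ix; rewrite homeo_mulE (notsupp (f := homeo_pow line_r 12)) //.
by move=> /supp_iter; apply; exact: line_r_unit.
Qed.

(** Since [h] preserves the support of [hq], the image of (0, 1) avoids 0 and 1, which [line_q]
    fixes. Being connected and meeting (0, 1), it stays inside. *)
Lemma dom_unit (h : homeo (\bar R)) : dom line_t line_c line_r h ->
  (exists x, unit_itv x /\ unit_itv (h x)) -> forall x, unit_itv x -> unit_itv (h x).
Proof.
move=> [_ hq_comm] [y [Iy Ihy]].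
have Sq z : unit_itv z -> supp (hq line_c line_r) (h z).
  move=> Iz; apply/(supp_commutes z hq_comm) => E; have /line_hb_supp := Iz; apply.
  by rewrite -line_hq_unit.
have im : connected (h @` unit_itv).
  apply: connected_continuous_connected; first exact: unit_itv_connected.
  exact/continuous_subspaceT/homeo_continuous.
have q01 z : line_q z = z -> ~ (h @` unit_itv) z.
  by move=> qz [v /Sq + E]; rewrite E line_hq => /supp_iter; apply.
have sub := connected_in_unit im (q01 _ line_q_0) (q01 _ line_q_1).
move=> x Ix; apply: sub; last by exists x.
by exists (h y); split => //; exists y.
Qed.

Lemma line_good_params : good_params line_t line_c line_r.
Proof.
have M := ereal_manifold; have haus : hausdorff_space (\bar R) by case: M.
have moving := manifold_locally_moving M.
have tq : commutes line_t (hq line_c line_r).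
  by rewrite line_hq; apply/commutes_sym/commutes_pow/commutes_sym/line_t_q.
have br : detached (hb line_c) line_r.
  apply: disjoint_detached => // x /line_hb_supp/line_r_unit E.
  by apply.
(* Either [h] maps (0, 1) onto itself, where [hb] agrees with [hq] and is unchanged by conjugation
   with [h], or [h] moves (0, 1) off itself. *)
have disj h : dom line_t line_c line_r h ->
    translate line_c h = hb line_c \/ detached (translate line_c h) line_c.
  move=> hD; have [[x [Ix Ihx]]|H] := pselect (exists x, unit_itv x /\ unit_itv (h x)).
    left; have hI := dom_unit hD (ex_intro _ x (conj Ix Ihx)).
    have hVI : forall z, unit_itv z -> unit_itv (h^V z).
      apply: dom_unit; first exact: dom_inv.
      by exists (h x); rewrite homeoK.
    apply: homeo_ext => z; rewrite hconjE; have [Iz|Iz] := pselect (unit_itv z).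
      rewrite -line_hq_unit; last exact: hVI.
      by case: hD => _ /commutesP ->; rewrite homeoVK line_hq_unit.
    rewrite (@notsupp _ _ (h^V z)); last first.
      by move=> /line_hb_supp/hI; rewrite homeoVK.
    by rewrite homeoVK notsupp // => /line_hb_supp.
  right; apply: disjoint_detached => // z /supp_conj/line_hb_supp Iz /line_c_supp Iz'.
  by apply: H; exists (h^V z); rewrite homeoVK.
have half : unit_itv (1 / 2)%:E by apply/unit_itvP; lra.
have b12 : homeo_pow (hb line_c) 12 <> homeo_one _.
  move=> E; have := (unit_decreasing_pow 11 line_hb_decreasing half).2.
  by rewrite E ltxx.
(* [naturalP] rests on the first four conditions alone, so it may be used for the fifth: a natural
   element acts as a power of the shift, and t^(n+1) takes 1/2 out of (0, 1). *)
split => // h /(naturalP haus moving (manifold_locally_connected M) tq br disj b12).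
move=> [n [hD hn]] E; have E' : translate line_c (homeo_pow line_t n.+1) = hb line_c.
  by rewrite -E homeo_powS !translate_mul hn.
have tn k u : homeo_pow line_t k u%:E = (u + k%:R)%:E.
  rewrite homeo_powE; elim: k => [|k IH]; first by rewrite addr0.
  by rewrite iterS IH -addn1 natrD addrA.
have : supp (hb line_c) (homeo_pow line_t n.+1 (1 / 2)%:E).
  by rewrite -E'; apply/supp_conj; rewrite homeoK; exact/line_hb_supp.
rewrite tn => /line_hb_supp/unit_itvP.
have E2 : n.+1%:R = n%:R + 1 :> R by rewrite natr1.
by have := ler0n R n; rewrite E2; lra.
Qed.

End GoodParams.

(** * First-order formulas *)

Section Formulas.

Fixpoint term_below (k : nat) (s : gterm) : bool :=
  match s with
  | GVar n => n < k
  | GOne => true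
  | GMul s u => term_below k s && term_below k u
  | GInv s => term_below k s
  end.

Definition pow_term (s : gterm) n := iter n (GMul s) GOne.
Definition b_term := pow_term (GVar 1) 12.
Definition q_term := GMul b_term (pow_term (GVar 2) 12).
Definition translate_term x := GMul (GMul x b_term) (GInv x).
Global Arguments pow_term : simpl never.
Global Arguments b_term : simpl never.
Global Arguments q_term : simpl never.

Definition comm_term s u := GMul (GMul (GMul s u) (GInv s)) (GInv u).
Definition commutes_form s u := GEq (GMul s u) (GMul u s).

(* In all the formulas below, [k] is a strict bound on the variables of the argument terms;
   the variables from [k] on are free for use as bound variables. *)
Definition detached_form k s u :=
  let w := comm_term (GVar k.+1) (comm_term (GVar k.+2) (GVar k)) in
  GAll k (GImp (GNot (commutes_form (GVar k) s))
    (GEx k.+1 (GEx k.+2 (GAnd (commutes_form (GVar k.+1) u)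
      (GAnd (commutes_form (GVar k.+2) u)
        (GAnd (commutes_form w u) (GNot (GEq w GOne)))))))).

Definition member_form k x y := GNot (detached_form k (translate_term x) y).

Definition dom_form x := GAnd (commutes_form x (GVar 0)) (commutes_form x q_term).

Definition closed_under_form k y (step : gterm -> gterm) (D : nat -> gterm -> gform) :=
  GAll k (GImp (D k.+1 (GVar k)) (GImp (member_form k.+1 (GVar k) y)
    (member_form k.+1 (step (GVar k)) y))).

Definition natural_form k x := GAnd (dom_form x)
  (GAll k (GImp (member_form k.+1 GOne (GVar k))
    (GImp (closed_under_form k.+1 (GVar k) (GMul (GVar 0)) (fun _ => dom_form))
      (member_form k.+1 x (GVar k))))).

Definition good_form :=
  GAnd (commutes_form (GVar 0) q_term)
    (GAnd (detached_form 4 b_term (GVar 2))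
      (GAnd (GAll 4 (GImp (dom_form (GVar 4))
          (GOr (GEq (translate_term (GVar 4)) b_term)
            (detached_form 5 (translate_term (GVar 4)) (GVar 1)))))
        (GAnd (GNot (GEq (pow_term b_term 12) GOne))
          (GAll 4 (GImp (natural_form 5 (GVar 4))
            (GNot (GEq (translate_term (GMul (GVar 0) (GVar 4))) b_term))))))).

Definition eq_form x y := GEq (translate_term x) (translate_term y).

Definition exists_natural k p := GEx k (GAnd (natural_form k.+1 (GVar k)) p).

Definition lt_form k x y :=
  exists_natural k (eq_form (GMul (GVar 0) (GMul x (GVar k))) y).

(** [y] lies in every set that contains 0 and is closed under adding [x], so divisibility needs only
    sets and addition. *)
Definition dvd_form k x y :=
  GAll k (GImp (member_form k.+1 GOne (GVar k))
    (GImp (closed_under_form k.+1 (GVar k) (fun z => GMul z x) natural_form)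
      (member_form k.+1 y (GVar k)))).

(* [y = x (x + 1)], as the least common multiple of [x] and [x + 1]. *)
Definition oblong_form k x y :=
  let x1 := GMul (GVar 0) x in
  GAnd (dvd_form k x y) (GAnd (dvd_form k x1 y)
    (GAll k (GImp (natural_form k.+1 (GVar k))
      (GImp (dvd_form k.+1 x (GVar k)) (GImp (dvd_form k.+1 x1 (GVar k))
        (dvd_form k.+1 y (GVar k))))))).

(* [(x + y)(x + y + 1) = x(x + 1) + y(y + 1) + 2 z] *)
Definition times_form k x y z :=
  let u := GVar k in let v := GVar k.+1 in let w := GVar k.+2 in
  exists_natural k (exists_natural k.+1 (exists_natural k.+2
    (GAnd (oblong_form k.+3 x u) (GAnd (oblong_form k.+3 y v)
      (GAnd (oblong_form k.+3 (GMul x y) w)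
        (eq_form w (GMul (GMul u v) (GMul z z)))))))).

End Formulas.

(** * Semantics of the formulas *)

Lemma upd_eq (A : Type) (e : nat -> A) j a : upd e j a j = a.
Proof. by rewrite /upd eqxx. Qed.

Lemma upd_neq (A : Type) (e : nat -> A) i j a : i != j -> upd e j a i = e i.
Proof. by rewrite /upd => /negbTE ->. Qed.

Section Semantics.
Variable T : topologicalType.
Implicit Types (e : nat -> homeo T).

Local Notation ev e s := (@geval (Homeo T) e s).
Local Notation sat e p := (@gsat (Homeo T) e p).

Definition agree (k : nat) e e' := forall j, j < k -> e j = e' j.

Lemma agree_upd k j e e' (a : homeo T) : k <= j -> agree k e e' -> agree k e (upd e' j a).
Proof.
move=> kj ee' i ik; rewrite /upd; case: eqP => [E|_]; last exact: ee'.
by move: ik; rewrite E ltnNge kj.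
Qed.

Lemma agree_le k k' e e' : k <= k' -> agree k' e e' -> agree k e e'.
Proof. by move=> kk' ee' j jk; apply: ee'; exact: leq_trans kk'. Qed.

Lemma agree_trans k e e' e'' : agree k e e' -> agree k e' e'' -> agree k e e''.
Proof. by move=> A B j jk; rewrite A // B. Qed.

Lemma geval_agree k e e' s : term_below k s -> agree k e e' -> ev e' s = ev e s.
Proof.
move=> sk ee'; elim: s sk => //= [n nk|s IHs u IHu /andP[sk uk]|s IHs sk].
- by rewrite ee'.
- by rewrite IHs ?IHu.
- by rewrite IHs.
Qed.

Lemma term_below_le k k' s : k <= k' -> term_below k s -> term_below k' s.
Proof.
move=> kk'; elim: s => //= [n nk|s IHs u IHu /andP[sk uk]]; first exact: leq_trans kk'.
by rewrite IHs ?IHu.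
Qed.

Lemma geval_upd k j e s (a : homeo T) : term_below k s -> k <= j -> ev (upd e j a) s = ev e s.
Proof. by move=> sk kj; apply: geval_agree sk _; apply: agree_upd. Qed.

Lemma sat_eq e s u : sat e (GEq s u) <-> ev e s = ev e u.
Proof. by split; [exact: homeo_ext|move=> /= ->]. Qed.

Lemma sat_commutes e s u : sat e (commutes_form s u) <-> commutes (ev e s) (ev e u).
Proof. exact: sat_eq. Qed.

Lemma geval_pow e s n : ev e (pow_term s n) = homeo_pow (ev e s) n.
Proof. by elim: n => // n IH; rewrite homeo_powS -IH. Qed.

Lemma sat_detached e k s u : term_below k s -> term_below k u ->
  sat e (detached_form k s u) <-> detached (ev e s) (ev e u).
Proof.
move=> sk uk; rewrite /detached_form.
have S a : ev (upd e k a) s = ev e s by rewrite (geval_upd _ _ sk).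
have U a b c : ev (upd (upd (upd e k a) k.+1 b) k.+2 c) u = ev e u.
  by rewrite !(geval_upd _ _ uk) // ?leqW.
have E a b c : let e' := upd (upd (upd e k a) k.+1 b) k.+2 c in
    [/\ e' k = a, e' k.+1 = b & e' k.+2 = c].
  by rewrite /= /upd; split; do ?(case: eqP => //=); lia.
split.
- move=> H h hs; have [|a [b [/sat_commutes A [/sat_commutes B [/sat_commutes C D]]]]] := H h.
    by move=> /sat_commutes; rewrite S /= upd_eq.
  have [Ek Eb Ec] := E h a b; move: A B C D; rewrite !U /= Ek Eb Ec => A B C D.
  by exists a, b; split => // X; apply: D => z; exact: (congr1 (fun u : homeo T => u z) X).
- move=> H h hs; have [|a [b [A B C D]]] := H h.
    by move=> C; apply: hs; apply/sat_commutes; rewrite S /= upd_eq.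
  have [Ek Eb Ec] := E h a b.
  exists a, b; split; first by apply/sat_commutes; rewrite U /= Eb.
  split; first by apply/sat_commutes; rewrite U /= Ec.
  split; first by apply/sat_commutes; rewrite U /= Ek Eb Ec.
  by move=> /sat_eq X; apply: D; move: X; rewrite /= Ek Eb Ec.
Qed.

Section Based.
Variables t c r : homeo T.
Definition based e := [/\ e 0 = t, e 1 = c & e 2 = r].

Lemma based_agree k e e' : 3 <= k -> agree k e e' -> based e -> based e'.
Proof. by move=> k3 A [E0 E1 E2]; split; rewrite -A //; exact: leq_trans k3. Qed.

Lemma based_upd k e (a : homeo T) : 3 <= k -> based e -> based (upd e k a).
Proof. by move=> k3; apply: based_agree k3 _; apply: agree_upd. Qed.

Lemma geval_b e : based e -> ev e b_term = hb c.
Proof. by case=> _ E _; rewrite /b_term geval_pow /= E. Qed.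

Lemma geval_q e : based e -> ev e q_term = hq c r.
Proof.
move=> B; have -> : ev e q_term = ev e b_term ** ev e (pow_term (GVar 2) 12) by [].
by rewrite geval_b // geval_pow; case: B => _ _ /= ->.
Qed.

Lemma geval_translate e s : based e -> ev e (translate_term s) = translate c (ev e s).
Proof.
move=> B; have -> : ev e (translate_term s) = ev e s ** ev e b_term ** (ev e s)^V by [].
by rewrite geval_b.
Qed.

Lemma translate_term_below k s : 3 <= k -> term_below k s -> term_below k (translate_term s).
Proof. by move=> k3 sk /=; rewrite sk; do !(apply/andP; split => //); exact: leq_trans k3. Qed.

Lemma sat_member e k x y : based e -> 3 <= k -> term_below k x -> term_below k y ->
  sat e (member_form k x y) <-> member c (ev e x) (ev e y).
Proof.
move=> B k3 xk yk; rewrite /member -geval_translate //.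
by rewrite -(sat_detached e (translate_term_below k3 xk) yk).
Qed.

Lemma sat_dom e x : based e -> sat e (dom_form x) <-> dom t c r (ev e x).
Proof.
move=> B; rewrite /dom -(geval_q B); have <- : ev e (GVar 0) = t by case: B.
by split=> -[/sat_commutes ? /sat_commutes ?].
Qed.

Lemma sat_closed_under e k y (step : gterm -> gterm) (f : homeo T -> homeo T) D
    (P : homeo T -> Prop) :
  based e -> 3 <= k -> term_below k y -> term_below k.+1 (step (GVar k)) ->
  (forall a, ev (upd e k a) (step (GVar k)) = f a) ->
  (forall a, sat (upd e k a) (D k.+1 (GVar k)) <-> P a) ->
  sat e (closed_under_form k y step D) <->
  forall a, P a -> member c a (ev e y) -> member c (f a) (ev e y).
Proof.
move=> B k3 yk sk fE PE; have yk1 : term_below k.+1 y by exact: term_below_le yk.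
have M1 a : sat (upd e k a) (member_form k.+1 (GVar k) y) <-> member c a (ev e y).
  rewrite sat_member //=; [|exact: based_upd|exact: leqW].
  by rewrite (geval_upd _ _ yk) // upd_eq.
have M2 a : sat (upd e k a) (member_form k.+1 (step (GVar k)) y) <-> member c (f a) (ev e y).
  rewrite sat_member //=; [|exact: based_upd|exact: leqW].
  by rewrite (geval_upd _ _ yk) // fE.
split=> H a.
  by move=> /PE Pa /M1 Ma; apply/M2; exact: H.
by move=> /PE Pa /M1 Ma; apply/M2; exact: H.
Qed.

Lemma sat_natural e k x : based e -> 3 <= k -> term_below k x ->
  sat e (natural_form k x) <-> natural t c r (ev e x).
Proof.
move=> B k3 xk; have k31 : 3 <= k.+1 by exact: leqW.
have Bu a : based (upd e k a) by exact: based_upd.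
have M1 a : sat (upd e k a) (member_form k.+1 GOne (GVar k)) <-> member c (homeo_one T) a.
  by rewrite sat_member //= upd_eq.
have M2 a : sat (upd e k a) (member_form k.+1 x (GVar k)) <-> member c (ev e x) a.
  by rewrite sat_member //= ?upd_eq ?(geval_upd _ _ xk) //; exact: term_below_le xk.
have CU a : sat (upd e k a) (closed_under_form k.+1 (GVar k) (GMul (GVar 0)) (fun=> dom_form))
    <-> forall h, dom t c r h -> member c h a -> member c (t ** h) a.
  suff : sat (upd e k a) (closed_under_form k.+1 (GVar k) (GMul (GVar 0)) (fun=> dom_form))
      <-> forall h, dom t c r h -> member c h (ev (upd e k a) (GVar k)) ->
        member c (t ** h) (ev (upd e k a) (GVar k)).
    by rewrite (_ : ev (upd e k a) (GVar k) = a) //; exact: upd_eq.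
  apply: (sat_closed_under (f := fun h => t ** h) (P := dom t c r)).
  - exact: Bu.
  - exact: k31.
  - exact: ltnSn.
  - by rewrite /= ltnSn.
  - by move=> h; rewrite /= upd_eq; case: (based_upd h k31 (Bu a)) => ->.
  - move=> h; rewrite sat_dom; last exact: based_upd.
    by rewrite [ev _ _](upd_eq _ k.+1).
split.
  move=> [/(sat_dom x B) xD H]; split => // y y1 yS; apply/M2; apply: H; first exact/M1.
  exact/CU.
move=> [xD H]; split; first exact/sat_dom.
by move=> y /M1 y1 /CU yS; apply/M2; exact: H.
Qed.

Lemma sat_good e : based e -> sat e good_form <-> good_params t c r.
Proof.
move=> B.
have Bu a : based (upd e 4 a) by exact: based_upd.
have E1 a : ev (upd e 4 a) (GVar 4) = a by rewrite /= upd_eq.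
have N a : sat (upd e 4 a) (natural_form 5 (GVar 4)) <-> natural t c r a.
  by rewrite sat_natural // E1.
have D a : sat (upd e 4 a) (dom_form (GVar 4)) <-> dom t c r a by rewrite sat_dom // E1.
have F1 : sat e (commutes_form (GVar 0) q_term) <-> commutes t (hq c r).
  by rewrite sat_commutes geval_q //=; case: B => ->.
have F2 : sat e (detached_form 4 b_term (GVar 2)) <-> detached (hb c) r.
  by rewrite sat_detached // geval_b //=; case: B => _ _ ->.
have F3 a : sat (upd e 4 a) (GEq (translate_term (GVar 4)) b_term) <-> translate c a = hb c.
  by rewrite sat_eq geval_translate // geval_b // E1.
have F4 a : sat (upd e 4 a) (detached_form 5 (translate_term (GVar 4)) (GVar 1)) <->
    detached (translate c a) c.
  by rewrite sat_detached // geval_translate // E1; case: (Bu a) => _ /= ->.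
have F5 : sat e (GEq (pow_term b_term 12) GOne) <-> homeo_pow (hb c) 12 = homeo_one T.
  by rewrite sat_eq geval_pow geval_b.
have F6 a : sat (upd e 4 a) (GEq (translate_term (GMul (GVar 0) (GVar 4))) b_term) <->
    translate c (t ** a) = hb c.
  by rewrite sat_eq geval_translate // geval_b //= upd_eq; case: (Bu a) => ->.
split.
  move=> [/F1 H1 [/F2 H2 [H3 [H4 H5]]]]; split => //.
  - by move=> a /D aD; case: (H3 a aD) => [/F3|/F4]; [left|right].
  - by move=> X; apply: H4; exact/F5.
  - by move=> a /N aN X; apply: (H5 a aN); exact/F6.
move=> [H1 H2 H3 H4 H5]; split; first exact/F1.
split; first exact/F2.
split; first by move=> a /D /H3 [H|H]; [left; exact/F3|right; exact/F4].
by split; [move=> /F5|move=> a /N aN /F6; exact: H5].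
Qed.

End Based.
End Semantics.

(** m and m + 1 are coprime, so their product is their least common multiple. *)
Lemma oblong_lcm m n :
  n = (m * m.+1)%N <-> [/\ m %| n, m.+1 %| n & forall w, m %| w -> m.+1 %| w -> n %| w].
Proof.
split=> [->|[mn mn1 H]].
  split; [exact: dvdn_mulr|exact: dvdn_mull|].
  by move=> w mw m1w; rewrite Gauss_dvd ?coprimenS // mw.
apply/eqP; rewrite eqn_dvd; apply/andP; split; first by apply: H; [exact: dvdn_mulr|exact: dvdn_mull].
by rewrite Gauss_dvd ?coprimenS // mn.
Qed.

(** * Order, divisibility and multiplication under good parameters *)

Section Arithmetic.
Variable T : topologicalType.
Hypothesis haus : hausdorff_space T.
Hypothesis moving : locally_moving T.
Hypothesis lconn : locally_connected T.
Variables t c r : homeo T.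
Hypothesis good : good_params t c r.
Implicit Types (e : nat -> homeo T) (a : homeo T).

Local Notation ev e s := (@geval (Homeo T) e s).
Local Notation sat e p := (@gsat (Homeo T) e p).
Local Notation rep := (represents t c r).
Local Notation based := (based t c r).

Lemma natural_rep a : natural t c r a <-> exists n, rep a n.
Proof. by case: good => *; exact: naturalP. Qed.

Lemma rep_natural a n : rep a n -> natural t c r a.
Proof. by move=> an; apply/natural_rep; exists n. Qed.

Lemma rep_pow n : rep (homeo_pow t n) n.
Proof. by case: good => *; exact: represents_pow. Qed.

Lemma rep_one : rep (homeo_one T) 0.
Proof. exact: rep_pow 0. Qed.

Lemma rep_mul a a' m n : rep a m -> rep a' n -> rep (a ** a') (m + n).
Proof. by case: good => *; exact: represents_mul. Qed.

Lemma rep_succ a n : rep a n -> rep (t ** a) n.+1.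
Proof.
move=> an; rewrite -add1n; apply: rep_mul an.
by rewrite -[X in represents _ _ _ X](homeo_mul1 t); exact: rep_pow 1.
Qed.

Lemma rep_eq a a' m n : rep a m -> rep a' n -> translate c a = translate c a' <-> m = n.
Proof. by case: good => tq br disj b12 ap; apply: represents_eq. Qed.

Lemma rep_set (X : nat -> Prop) : exists y, forall a n, rep a n -> member c a y <-> X n.
Proof. by case: good => tq br disj b12 ap; apply: set_exists. Qed.

Lemma rep_member a n y : rep a n -> member c a y <-> member c (homeo_pow t n) y.
Proof. by move=> [_ an]; split; apply: member_eq. Qed.

Lemma sat_eq_form e x y m n : based e -> rep (ev e x) m -> rep (ev e y) n ->
  sat e (eq_form x y) <-> m = n.
Proof.
move=> B xm yn; rewrite -(rep_eq xm yn) -!(geval_translate _ B).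
exact: sat_eq.
Qed.

Lemma sat_natural_var e k a : based e -> 3 <= k ->
  sat (upd e k a) (natural_form k.+1 (GVar k)) <-> natural t c r a.
Proof.
move=> B k3; rewrite (sat_natural (t := t) (c := c) (r := r)).
- by rewrite [ev _ _](upd_eq e k).
- exact: based_upd.
- exact: leqW.
- exact: ltnSn.
Qed.

Lemma sat_exists_natural e k p (P : nat -> Prop) : based e -> 3 <= k ->
  (forall a n, rep a n -> sat (upd e k a) p <-> P n) ->
  sat e (exists_natural k p) <-> exists n, P n.
Proof.
move=> B k3 pP; split.
  move=> [a [/(sat_natural_var a B k3)/natural_rep [n an] /(pP a n an) Pn]].
  by exists n.
move=> [n Pn]; exists (homeo_pow t n); split; last exact/(pP _ n (rep_pow n)).
exact/(sat_natural_var _ B k3)/rep_natural/rep_pow.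
Qed.

Lemma sat_forall_natural e k p (P : nat -> Prop) : based e -> 3 <= k ->
  (forall a n, rep a n -> sat (upd e k a) p <-> P n) ->
  sat e (GAll k (GImp (natural_form k.+1 (GVar k)) p)) <-> forall n, P n.
Proof.
move=> B k3 pP; split=> [H n|H a].
  apply/(pP _ n (rep_pow n)); apply: H.
  exact/(sat_natural_var _ B k3)/rep_natural/rep_pow.
by move=> /(sat_natural_var a B k3)/natural_rep [n an]; apply/(pP a n an).
Qed.

Lemma sat_dvd e k x y m n : based e -> 3 <= k -> term_below k x -> term_below k y ->
  rep (ev e x) m -> rep (ev e y) n -> sat e (dvd_form k x y) <-> m %| n.
Proof.
move=> B k3 xk yk xm yn; have k31 : 3 <= k.+1 by exact: leqW.
have Bu a : based (upd e k a) by exact: based_upd.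
have V a : ev (upd e k a) (GVar k) = a by exact: upd_eq.
have vk : term_below k.+1 (GVar k) by exact: ltnSn.
have M1 a : sat (upd e k a) (member_form k.+1 GOne (GVar k)) <-> member c (homeo_one T) a.
  by rewrite (sat_member (Bu a) k31 _ vk) // V.
have M2 a : sat (upd e k a) (member_form k.+1 y (GVar k)) <-> member c (ev e y) a.
  rewrite (sat_member (Bu a) k31 _ vk) ?V ?(geval_upd _ _ yk) //.
  exact: term_below_le yk.
have CU a : sat (upd e k a)
      (closed_under_form k.+1 (GVar k) (fun z => GMul z x) natural_form) <->
    forall h, natural t c r h -> member c h a -> member c (h ** ev e x) a.
  suff : sat (upd e k a) (closed_under_form k.+1 (GVar k) (fun z => GMul z x) natural_form) <->
    forall h, natural t c r h -> member c h (ev (upd e k a) (GVar k)) ->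
      member c (h ** ev e x) (ev (upd e k a) (GVar k)) by rewrite V.
  apply: (sat_closed_under (f := fun h => h ** ev e x) (P := natural t c r)).
  - exact: Bu.
  - exact: k31.
  - exact: vk.
  - by rewrite /= leqnn (term_below_le _ xk) // !leqW.
  - move=> h; rewrite -[LHS]/(ev _ (GVar k.+1) ** ev _ x).
    by rewrite !(geval_upd _ _ xk) // ?leqW // [ev _ (GVar _)](upd_eq _ k.+1).
  - by move=> h; exact: sat_natural_var.
split=> [H|/dvdnP [q nq]].
  (* The test set is the set of multiples of [m]; that it is coded turns the closure condition into
     true divisibility. *)
  have [Y YP] := rep_set (fun w => m %| w).
  apply/(YP _ _ yn)/M2/H; first exact/M1/(YP _ _ rep_one).
  apply/CU => h /natural_rep [w hw] /(YP _ _ hw) mw.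
  by apply/(YP _ _ (rep_mul hw xm)); rewrite dvdn_addl.
move=> Y /M1 Y1 /CU YC; apply/M2/(rep_member _ yn); rewrite nq.
elim: q {nq} => [|q IH]; first by rewrite mul0n.
rewrite mulSn addnC; apply/(rep_member _ (rep_mul (rep_pow (q * m)) xm)).
by apply: YC => //; exact: rep_natural (rep_pow _).
Qed.

Lemma sat_oblong e k x y m n : based e -> 3 <= k -> term_below k x -> term_below k y ->
  rep (ev e x) m -> rep (ev e y) n -> sat e (oblong_form k x y) <-> n = (m * m.+1)%N.
Proof.
move=> B k3 xk yk xm yn; rewrite oblong_lcm.
have x1m e' : based e' -> rep (ev e' x) m -> rep (ev e' (GMul (GVar 0) x)) m.+1.
  move=> [E _ _] H; rewrite -[ev _ _]/(ev e' (GVar 0) ** ev e' x) [ev _ (GVar 0)]E.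
  exact: rep_succ.
have x1k k' : k <= k' -> term_below k' (GMul (GVar 0) x).
  by move=> kk'; rewrite /= (term_below_le kk' xk) andbT; lia.
have D1 := sat_dvd B k3 xk yk xm yn.
have D2 := sat_dvd B k3 (x1k _ (leqnn k)) yk (x1m _ B xm) yn.
have D3 : sat e (GAll k (GImp (natural_form k.+1 (GVar k))
      (GImp (dvd_form k.+1 x (GVar k)) (GImp (dvd_form k.+1 (GMul (GVar 0) x) (GVar k))
        (dvd_form k.+1 y (GVar k)))))) <-> forall w, m %| w -> m.+1 %| w -> n %| w.
  apply: sat_forall_natural => // a w aw.
  have Bu : based (upd e k a) by exact: based_upd.
  have k31 : 3 <= k.+1 by exact: leqW.
  have vk : term_below k.+1 (GVar k) by exact: ltnSn.
  have V : rep (ev (upd e k a) (GVar k)) w by rewrite [ev _ _](upd_eq e k).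
  have xm' : rep (ev (upd e k a) x) m by rewrite (geval_upd _ _ xk).
  have yn' : rep (ev (upd e k a) y) n by rewrite (geval_upd _ _ yk).
  have A1 := sat_dvd Bu k31 (term_below_le (leqnSn k) xk) vk xm' V.
  have A2 := sat_dvd Bu k31 (x1k _ (leqnSn k)) vk (x1m _ Bu xm') V.
  have A3 := sat_dvd Bu k31 (term_below_le (leqnSn k) yk) vk yn' V.
  by split=> H /A1 H1 /A2 H2; apply/A3; exact: H.
by split=> [[/D1 ? [/D2 ? /D3 ?]]|[? ? ?]]; [split|split; [exact/D1|split; [exact/D2|exact/D3]]].
Qed.

Lemma sat_lt e k x y m n : based e -> 3 <= k -> term_below k x -> term_below k y ->
  rep (ev e x) m -> rep (ev e y) n -> sat e (lt_form k x y) <-> m < n.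
Proof.
move=> B k3 xk yk xm yn.
have -> : (m < n) <-> exists w, (m + w).+1 = n.
  by split=> [mn|[w <-]]; [exists (n - m.+1); lia|lia].
apply: sat_exists_natural => // a w aw.
have Bu : based (upd e k a) by exact: based_upd.
apply: sat_eq_form => //; last by rewrite (geval_upd _ _ yk).
rewrite -[ev _ _]/(ev (upd e k a) (GVar 0) ** (ev (upd e k a) x ** ev (upd e k a) (GVar k))).
rewrite [ev _ (GVar k)](upd_eq e k) (geval_upd _ _ xk) // [ev _ (GVar 0)](_ : _ = t); last by case: Bu.
exact/rep_succ/rep_mul.
Qed.

Lemma oblong_times m n p : (m * n)%N = p <->
  ((m + n) * (m + n).+1 = m * m.+1 + n * n.+1 + (p + p))%N.
Proof. by split=> [<-|]; nia. Qed.

Lemma sat_times e k x y z m n p : based e -> 3 <= k ->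
  term_below k x -> term_below k y -> term_below k z ->
  rep (ev e x) m -> rep (ev e y) n -> rep (ev e z) p ->
  sat e (times_form k x y z) <-> (m * n)%N = p.
Proof.
move=> B k3 xk yk zk xm yn zp.
have -> : (m * n)%N = p <-> exists u v w,
    [/\ u = m * m.+1, v = n * n.+1, w = (m + n) * (m + n).+1 & w = u + v + (p + p)]%N.
  rewrite oblong_times; split=> [H|[u [v [w [-> -> -> H]]]]]; last exact: H.
  by do 3 eexists; split; [reflexivity|reflexivity|reflexivity|exact: H].
apply: sat_exists_natural => // a u au; apply: sat_exists_natural.
- exact: based_upd.
- exact: leqW.
move=> b v bv; apply: sat_exists_natural.
- by do !apply: based_upd => //; exact: leqW.
- by rewrite !leqW.
move=> d w dw; set e' := upd _ k.+2 d.
have B' : based e' by do !apply: based_upd => //; rewrite ?leqW.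
have k33 : 3 <= k.+3 by rewrite !leqW.
have ag : agree k e e' by do !apply: agree_upd; rewrite ?leqW.
have kk : k <= k.+3 by rewrite !leqW.
have U : rep (ev e' (GVar k)) u.
  by rewrite /= /e' 2?upd_neq ?upd_eq //; lia.
have V : rep (ev e' (GVar k.+1)) v by rewrite /= /e' upd_neq ?upd_eq //; lia.
have W : rep (ev e' (GVar k.+2)) w by rewrite /= /e' upd_eq.
have X : rep (ev e' x) m by rewrite (geval_agree xk ag).
have Y : rep (ev e' y) n by rewrite (geval_agree yk ag).
have Z : rep (ev e' z) p by rewrite (geval_agree zk ag).
have xk' := term_below_le kk xk; have yk' := term_below_le kk yk.
have O1 : sat e' (oblong_form k.+3 x (GVar k)) <-> u = (m * m.+1)%N.
  by apply: sat_oblong; rewrite //= ltnS !leqW.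
have O2 : sat e' (oblong_form k.+3 y (GVar k.+1)) <-> v = (n * n.+1)%N.
  by apply: sat_oblong; rewrite //= ltnS !leqW.
have O3 : sat e' (oblong_form k.+3 (GMul x y) (GVar k.+2)) <->
    w = ((m + n) * (m + n).+1)%N.
  apply: sat_oblong => //; [by rewrite /= xk'|exact: ltnSn|exact: rep_mul].
have O4 : sat e' (eq_form (GVar k.+2) (GMul (GMul (GVar k) (GVar k.+1)) (GMul z z))) <->
    w = (u + v + (p + p))%N.
  by apply: sat_eq_form => //; exact: rep_mul (rep_mul U V) (rep_mul Z Z).
split=> [[/O1 ? [/O2 ? [/O3 ? /O4 ?]]]|[? ? ? ?]]; first by split.
by split; [exact/O1|split; [exact/O2|split; [exact/O3|exact/O4]]].
Qed.

End Arithmetic.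

(** * Translation of second-order arithmetic *)

(* The variables 0, 1, 2 hold the parameters. *)
Definition nvar i := (2 * i + 3)%N.
Definition svar i := (2 * i + 4)%N.

(* Products are not terms of the group language: the continuation [F] receives the
   first unused variable and a group term representing the value of [s]. *)
Fixpoint translate_aterm (k : nat) (s : aterm) (F : nat -> gterm -> gform) : gform :=
  match s with
  | AVar n => F k (GVar (nvar n))
  | AZero => F k GOne
  | ASucc s => translate_aterm k s (fun k x => F k (GMul (GVar 0) x))
  | APlus s u => translate_aterm k s (fun k x =>
      translate_aterm k u (fun k y => F k (GMul x y)))
  | ATimes s u => translate_aterm k s (fun k x => translate_aterm k u (fun k y =>
      exists_natural k (GAnd (times_form k.+1 x y (GVar k)) (F k.+1 (GVar k)))))
  end.

Fixpoint translate_aform (K : nat) (p : aform) : gform :=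
  match p with
  | AEq s u => translate_aterm K s (fun k x => translate_aterm k u (fun k y => eq_form x y))
  | ALt s u => translate_aterm K s (fun k x => translate_aterm k u (fun k y => lt_form k x y))
  | AMem s j => translate_aterm K s (fun k x => member_form k x (GVar (svar j)))
  | ANot p => GNot (translate_aform K p)
  | AAnd p q => GAnd (translate_aform K p) (translate_aform K q)
  | AOr p q => GOr (translate_aform K p) (translate_aform K q)
  | AImp p q => GImp (translate_aform K p) (translate_aform K q)
  | AAllN i p => GAll (nvar i) (GImp (natural_form K (GVar (nvar i))) (translate_aform K p))
  | AExN i p => GEx (nvar i) (GAnd (natural_form K (GVar (nvar i))) (translate_aform K p))
  | AAllS j p => GAll (svar j) (translate_aform K p)
  | AExS j p => GEx (svar j) (translate_aform K p)
  end.

Fixpoint aterm_bound (s : aterm) : nat :=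
  match s with
  | AVar n => (nvar n).+1
  | AZero => 0
  | ASucc s => aterm_bound s
  | APlus s u | ATimes s u => maxn (aterm_bound s) (aterm_bound u)
  end.

Fixpoint aform_bound (p : aform) : nat :=
  match p with
  | AEq s u | ALt s u => maxn (aterm_bound s) (aterm_bound u)
  | AMem s j => maxn (aterm_bound s) (svar j).+1
  | ANot p => aform_bound p
  | AAnd p q | AOr p q | AImp p q => maxn (aform_bound p) (aform_bound q)
  | AAllN i p | AExN i p => maxn (nvar i).+1 (aform_bound p)
  | AAllS j p | AExS j p => maxn (svar j).+1 (aform_bound p)
  end.

Section Translation.
Variable T : topologicalType.
Hypothesis haus : hausdorff_space T.
Hypothesis moving : locally_moving T.
Hypothesis lconn : locally_connected T.
Variables t c r : homeo T.
Hypothesis good : good_params t c r.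
Implicit Types (e : nat -> homeo T) (a : homeo T).

Local Notation ev e s := (@geval (Homeo T) e s).
Local Notation sat e p := (@gsat (Homeo T) e p).
Local Notation rep := (represents t c r).
Local Notation based := (based t c r).

(** Nothing is asked of the variables from [K] on, which the translation uses for its own bound
    variables. *)
Definition codes (K : nat) e (eps : nat -> nat) (s : nat -> nat -> Prop) :=
  (forall i, nvar i < K -> rep (e (nvar i)) (eps i)) /\
  (forall j, svar j < K -> forall a n, rep a n -> member c a (e (svar j)) <-> s j n).

Lemma codes_agree K e e' eps s : agree K e e' -> codes K e eps s -> codes K e' eps s.
Proof. by move=> A [N S]; split => i iK; rewrite -A //; [exact: N|exact: S]. Qed.

Lemma codes_updN K e eps s i a n : rep a n -> codes K e eps s ->
  codes K (upd e (nvar i) a) (upd eps i n) s.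
Proof.
move=> an [N S]; split=> j jK; rewrite /upd.
  have -> : (nvar j == nvar i) = (j == i) by apply/eqP/eqP => [|->//]; rewrite /nvar; lia.
  by case: eqP => // _; exact: N.
by rewrite (_ : _ == _ = false); [exact: S|apply/eqP; rewrite /svar /nvar; lia].
Qed.

Lemma codes_updS K e eps s j y (X : nat -> Prop) :
  (forall a n, rep a n -> member c a y <-> X n) -> codes K e eps s ->
  codes K (upd e (svar j) y) eps (upd s j X).
Proof.
move=> yX [N S]; split=> i iK; rewrite /upd.
  by rewrite (_ : _ == _ = false); [exact: N|apply/eqP; rewrite /svar /nvar; lia].
have -> : (svar i == svar j) = (i == j) by apply/eqP/eqP => [|->//]; rewrite /svar; lia.
by case: eqP => // _; exact: S.
Qed.

(** Products bind new variables on the way to the continuation, so [F] is evaluated in an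
    environment that agrees with [e] only below [k]. Its meaning [P] must not depend on that
    environment, and it varies in the induction because the continuation does. *)
Lemma sat_translate_aterm K k e eps s u F (P : Prop) :
  based e -> 3 <= K <= k -> codes K e eps s -> aterm_bound u <= K ->
  (forall k' x e', k <= k' -> agree k e e' -> term_below k' x ->
     rep (ev e' x) (aeval eps u) -> sat e' (F k' x) <-> P) ->
  sat e (translate_aterm k u F) <-> P.
Proof.
elim: u k e F P => [i||u IH|u IHu v IHv|u IHu v IHv] k e F P B Kk C uk FP /=;
  have [K3 KK] := andP Kk; have k3 := leq_trans K3 KK.
- by apply: FP => //; [exact: leq_trans KK|exact: C.1].
- by apply: FP => //; exact: rep_one.
- apply: IH => // k' x e' kk' A xk' xn; apply: FP => //.
    by rewrite /= xk' andbT; lia.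
  rewrite -[ev _ _]/(ev e' (GVar 0) ** ev e' x).
  rewrite [ev _ (GVar 0)](_ : _ = t); first exact: rep_succ.
  by case: (based_agree k3 A B).
- move: uk; rewrite /= geq_max => /andP[uk vk].
  apply: IHu => // k1 x e1 kk1 A1 xk1 xm.
  apply: IHv => //; first exact: based_agree k3 A1 B.
  + by rewrite K3 (leq_trans KK).
  + exact: codes_agree (agree_le KK A1) C.
  move=> k2 y e2 kk2 A2 yk2 yn; apply: FP.
  + exact: leq_trans kk2.
  + exact: agree_trans A1 (agree_le kk1 A2).
  + by rewrite /= yk2 (term_below_le kk2 xk1).
  + have xm' : rep (ev e2 x) (aeval eps u) by rewrite (geval_agree xk1 A2).
    exact: rep_mul xm' yn.
- move: uk; rewrite /= geq_max => /andP[uk vk].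
  apply: IHu => // k1 x e1 kk1 A1 xk1 xm.
  have B1 : based e1 by exact: based_agree k3 A1 B.
  apply: IHv => //.
  + by rewrite K3 (leq_trans KK).
  + exact: codes_agree (agree_le KK A1) C.
  move=> k2 y e2 kk2 A2 yk2 yn.
  have k13 := leq_trans k3 kk1; have k23 := leq_trans k13 kk2.
  have B2 : based e2 by exact: based_agree k13 A2 B1.
  have xm' : rep (ev e2 x) (aeval eps u) by rewrite (geval_agree xk1 A2).
  have xk2 := term_below_le kk2 xk1.
  have PE : P <-> exists n, (aeval eps u * aeval eps v)%N = n /\ P.
    by split=> [p|[n [_ p]]] //; eexists; split; first by reflexivity.
  rewrite {}PE; apply: (sat_exists_natural haus moving lconn good B2 k23) => a n an.
  have k231 : 3 <= k2.+1 by exact: leqW.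
  have Bu : based (upd e2 k2 a) by exact: based_upd.
  have V : rep (ev (upd e2 k2 a) (GVar k2)) n by rewrite [ev _ _](upd_eq e2 k2).
  have X : rep (ev (upd e2 k2 a) x) (aeval eps u) by rewrite (geval_upd _ _ xk2).
  have Y : rep (ev (upd e2 k2 a) y) (aeval eps v) by rewrite (geval_upd _ _ yk2).
  have vk2 : term_below k2.+1 (GVar k2) by exact: ltnSn.
  have TM := sat_times haus moving lconn good Bu k231 (term_below_le (leqnSn k2) xk2)
    (term_below_le (leqnSn k2) yk2) vk2 X Y V.
  have FV : (aeval eps u * aeval eps v)%N = n ->
      sat (upd e2 k2 a) (F k2.+1 (GVar k2)) <-> P.
    move=> E; apply: FP => //; last by rewrite (_ : aeval eps (ATimes u v) = n).
      by rewrite (leq_trans kk1) // leqW.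
    apply: agree_upd; first exact: leq_trans kk2.
    exact: agree_trans A1 (agree_le kk1 A2).
  split=> [[/TM E /(FV E) p]|[E p]]; first by split.
  by split; [exact/TM|exact/(FV E)].
Qed.

Lemma sat_translate_aterm2 K e eps s u v F (P : Prop) :
  based e -> 3 <= K -> codes K e eps s -> aterm_bound u <= K -> aterm_bound v <= K ->
  (forall k x y e', K <= k -> based e' -> term_below k x -> term_below k y ->
     rep (ev e' x) (aeval eps u) -> rep (ev e' y) (aeval eps v) -> sat e' (F k x y) <-> P) ->
  sat e (translate_aterm K u (fun k x => translate_aterm k v (fun k y => F k x y))) <-> P.
Proof.
move=> B K3 C uK vK FP; apply: (sat_translate_aterm (K := K) B _ C uK); first by rewrite K3 leqnn.
move=> k x e1 Kk A1 xk xm.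
have B1 : based e1 by exact: based_agree K3 A1 B.
apply: (sat_translate_aterm (K := K) B1 _ _ vK); first by rewrite K3.
  exact: codes_agree A1 C.
move=> k2 y e2 kk2 A2 yk2 yn; apply: FP => //.
- exact: leq_trans kk2.
- exact: based_agree (leq_trans K3 Kk) A2 B1.
- exact: term_below_le xk.
- by rewrite (geval_agree xk A2).
Qed.

Lemma nvar_ge3 i : 3 <= nvar i. Proof. by rewrite /nvar; lia. Qed.
Lemma svar_ge3 i : 3 <= svar i. Proof. by rewrite /svar; lia. Qed.

Lemma sat_natural_nvar K e i a : based e -> nvar i < K ->
  sat (upd e (nvar i) a) (natural_form K (GVar (nvar i))) <-> natural t c r a.
Proof.
move=> B iK; have K3 : 3 <= K by exact: leq_trans (nvar_ge3 i) (ltnW iK).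
have Bu : based (upd e (nvar i) a) by apply: based_upd => //; exact: nvar_ge3.
have V : term_below K (GVar (nvar i)) by [].
by rewrite (sat_natural Bu K3 V) [ev _ _](upd_eq e (nvar i)).
Qed.

Lemma sat_translate_aform K e eps s p :
  based e -> 3 <= K -> codes K e eps s -> aform_bound p <= K ->
  sat e (translate_aform K p) <-> asat eps s p.
Proof.
move=> B K3; elim: p e eps s B =>
  [u v|u v|u j|p IH|p IHp q IHq|p IHp q IHq|p IHp q IHq|i p IH|i p IH|j p IH|j p IH]
  e eps s B C; rewrite [aform_bound _]/= ?geq_max.
- move=> /andP[uK vK]; apply: (sat_translate_aterm2 B K3 C uK vK) => k x y e' Kk B' xk yk xm yn.
  exact: (sat_eq_form haus moving lconn good B' xm yn).
- move=> /andP[uK vK]; apply: (sat_translate_aterm2 B K3 C uK vK) => k x y e' Kk B' xk yk xm yn.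
  exact: (sat_lt haus moving lconn good B' (leq_trans K3 Kk) xk yk xm yn).
- move=> /andP[uK jK]; apply: (sat_translate_aterm (K := K) B _ C uK); first by rewrite K3 leqnn.
  move=> k x e1 Kk A1 xk xm.
  have jk : term_below k (GVar (svar j)) by exact: leq_trans Kk.
  rewrite (sat_member (based_agree K3 A1 B) (leq_trans K3 Kk) xk jk).
  rewrite -[ev e1 (GVar _)]/(e1 (svar j)) -A1 //.
  exact: C.2.
- by move=> pK; have H := IH _ _ _ B C pK; split=> X Y; apply: X; exact/H.
- move=> /andP[pK qK]; have Hp := IHp _ _ _ B C pK; have Hq := IHq _ _ _ B C qK.
  by split=> [[/Hp ? /Hq ?]|[? ?]]; split => //; [exact/Hp|exact/Hq].
- move=> /andP[pK qK]; have Hp := IHp _ _ _ B C pK; have Hq := IHq _ _ _ B C qK.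
  by split=> [[/Hp ?|/Hq ?]|[?|?]]; [left|right|left; exact/Hp|right; exact/Hq].
- move=> /andP[pK qK]; have Hp := IHp _ _ _ B C pK; have Hq := IHq _ _ _ B C qK.
  by split=> X /Hp Y; apply/Hq; exact: X.
- move=> /andP[iK pK].
  have H a n (an : rep a n) := IH _ _ _ (based_upd a (nvar_ge3 i) B) (codes_updN i an C) pK.
  split=> [X n|X a].
    apply/(H _ n (rep_pow good n)); apply: X.
    apply/(sat_natural_nvar _ B iK)/(rep_natural haus moving lconn good).
    exact: (rep_pow good).
  move=> /(sat_natural_nvar _ B iK)/(natural_rep haus moving lconn good) [n an].
  exact/(H a n an).
- move=> /andP[iK pK].
  have H a n (an : rep a n) := IH _ _ _ (based_upd a (nvar_ge3 i) B) (codes_updN i an C) pK.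
  split=> [[a [/(sat_natural_nvar _ B iK)/(natural_rep haus moving lconn good) [n an] X]]|[n X]].
    by exists n; exact/(H a n an).
  exists (homeo_pow t n); split; last exact/(H _ n (rep_pow good n)).
  apply/(sat_natural_nvar _ B iK)/(rep_natural haus moving lconn good).
  exact: (rep_pow good).
- move=> /andP[jK pK].
  have H y X (yX : forall a n, rep a n -> member c a y <-> X n) :=
    IH _ _ _ (based_upd y (svar_ge3 j) B) (codes_updS j yX C) pK.
  split=> [Y X|Y y].
    by have [y yX] := rep_set haus moving lconn good X; apply/(H y X yX); exact: Y.
  (* An arbitrary [y] codes a set, namely that of the n whose power of [t] is a member of it. So the
     quantifier over group elements ranges over exactly the sets of numbers. *)
  apply/(H y (fun n => member c (homeo_pow t n) y)) => [a n an|]; last exact: Y.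
  exact: rep_member an.
- move=> /andP[jK pK].
  have H y X (yX : forall a n, rep a n -> member c a y <-> X n) :=
    IH _ _ _ (based_upd y (svar_ge3 j) B) (codes_updS j yX C) pK.
  split=> [[y Y]|[X Y]].
    exists (fun n => member c (homeo_pow t n) y).
    apply/(H y (fun n => member c (homeo_pow t n) y)) => [a n an|]; last exact: Y.
    exact: rep_member an.
  by have [y yX] := rep_set haus moving lconn good X; exists y; apply/(H y X yX).
Qed.

End Translation.

(** * Coding and diagonalization *)

Fixpoint gterm_bound (s : gterm) : nat :=
  match s with
  | GVar n => n.+1
  | GOne => 0
  | GMul s u => maxn (gterm_bound s) (gterm_bound u)
  | GInv s => gterm_bound s
  end.

Fixpoint gform_bound (p : gform) : nat :=
  match p with
  | GEq s u => maxn (gterm_bound s) (gterm_bound u)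
  | GNot p => gform_bound p
  | GAnd p q | GOr p q | GImp p q => maxn (gform_bound p) (gform_bound q)
  | GAll n p | GEx n p => gform_bound p
  end.

Lemma gterm_free_bound k s : gterm_free k s -> k < gterm_bound s.
Proof.
by elim: s => //= [n /eqP ->//|s IHs u IHu /orP[/IHs|/IHu] H]; rewrite leq_max H ?orbT.
Qed.

Lemma gform_free_bound k p : gform_free k p -> k < gform_bound p.
Proof.
elim: p => //= [s u /orP[/gterm_free_bound|/gterm_free_bound] H
  |p IHp q IHq /orP[/IHp|/IHq] H|p IHp q IHq /orP[/IHp|/IHq] H
  |p IHp q IHq /orP[/IHp|/IHq] H|n p IH /andP[_ /IH]|n p IH /andP[_ /IH]] //;
  by rewrite leq_max H ?orbT.
Qed.

(* The guard makes closing off the unused variables harmless: sentences are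
   evaluated in the environment that is constantly equal to the identity. *)
Definition close_off (vs : seq nat) (p : gform) :=
  foldr (fun v q => GAll v (GImp (GEq (GVar v) GOne) q)) p vs.

Lemma close_off_free k vs p : gform_free k (close_off vs p) = (k \notin vs) && gform_free k p.
Proof.
elim: vs => //= v vs ->; rewrite in_cons negb_or orbF eq_sym.
by case: (k =P v).
Qed.

Lemma sat_close_off (T : topologicalType) (e : nat -> homeo T) vs p :
  (forall v, v \in vs -> e v = homeo_one T) ->
  gsat (G := Homeo T) e (close_off vs p) <-> gsat (G := Homeo T) e p.
Proof.
elim: vs => //= v vs IH H.
have E : upd e v (homeo_one T) = e.
  by apply: funext => i; rewrite /upd; case: eqP => // ->; rewrite H // mem_head.
have IH' : gsat (G := Homeo T) e (close_off vs p) <-> gsat (G := Homeo T) e p.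
  by apply: IH => u uvs; apply: H; rewrite in_cons uvs orbT.
rewrite -IH'; split=> [X|X a a1].
  by have := X (homeo_one T); rewrite E; apply => x; rewrite H ?mem_head.
have -> : a = homeo_one T.
  by apply: homeo_ext => z; have := a1 z; rewrite upd_eq.
by rewrite E.
Qed.

(** * Injectivity of the codes *)

Lemma double_cpair a b : (cpair a b + cpair a b = (a + b) * (a + b).+1 + (b + b))%N.
Proof.
rewrite /cpair addnACA addnn -mul2n mulnC divnK //.
by rewrite dvdn2 oddM oddS; case: odd.
Qed.

Lemma cpair_inj a b a' b' : cpair a b = cpair a' b' -> a = a' /\ b = b'.
Proof.
move=> E; have := double_cpair a b; rewrite E double_cpair.
have : a + b = a' + b' \/ a + b < a' + b' \/ a' + b' < a + b by lia.
by move=> [H|[H|H]]; nia.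
Qed.

Lemma gterm_code_inj : injective gterm_code.
Proof.
elim=> [n||s IHs u IHu|s IHs] [n'||s' u'|s'] /cpair_inj [] // _.
- by move=> ->.
- by move=> /cpair_inj [/IHs -> /IHu ->].
- by move=> /IHs ->.
Qed.

Lemma godel_inj : injective godel.
Proof.
elim=> [s u|p IH|p IHp q IHq|p IHp q IHq|p IHp q IHq|n p IH|n p IH]
  [s' u'|p'|p' q'|p' q'|p' q'|n' p'|n' p'] /cpair_inj [] // _.
- by move=> /cpair_inj [/gterm_code_inj -> /gterm_code_inj ->].
- by move=> /IH ->.
- by move=> /cpair_inj [/IHp -> /IHq ->].
- by move=> /cpair_inj [/IHp -> /IHq ->].
- by move=> /cpair_inj [/IHp -> /IHq ->].
- by move=> /cpair_inj [-> /IH ->].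
- by move=> /cpair_inj [-> /IH ->].
Qed.

Lemma aeval_free e e' u : (forall k, aterm_free k u -> e k = e' k) -> aeval e u = aeval e' u.
Proof.
elim: u => //= [n H|u IH H|u IHu v IHv H|u IHu v IHv H].
- exact: H.
- by rewrite IH.
- by rewrite IHu ?IHv // => k kv; apply: H; rewrite kv ?orbT.
- by rewrite IHu ?IHv // => k kv; apply: H; rewrite kv ?orbT.
Qed.

Lemma asat_free_imp e e' s s' p : (forall k, aform_freeN k p -> e k = e' k) ->
  (forall k, aform_freeS k p -> s k = s' k) -> asat e s p <-> asat e' s' p.
Proof.
elim: p e e' s s' =>
  [u v|u v|u j|p IH|p IHp q IHq|p IHp q IHq|p IHp q IHq|i p IH|i p IH|j p IH|j p IH]
  e e' s s' /= HN HS.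
- by rewrite (aeval_free (e' := e')) ?(aeval_free (u := v) (e' := e')) // => k kf;
    apply: HN; rewrite kf ?orbT.
- by rewrite (aeval_free (e' := e')) ?(aeval_free (u := v) (e' := e')) // => k kf;
    apply: HN; rewrite kf ?orbT.
- by rewrite (aeval_free HN) HS.
- by rewrite (IH e e' s s').
- have Hp : asat e s p <-> asat e' s' p.
    by apply: IHp => k kf; [apply: HN|apply: HS]; rewrite kf.
  have Hq : asat e s q <-> asat e' s' q.
    by apply: IHq => k kf; [apply: HN|apply: HS]; rewrite kf orbT.
  by rewrite Hp Hq.
- have Hp : asat e s p <-> asat e' s' p.
    by apply: IHp => k kf; [apply: HN|apply: HS]; rewrite kf.
  have Hq : asat e s q <-> asat e' s' q.
    by apply: IHq => k kf; [apply: HN|apply: HS]; rewrite kf orbT.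
  by rewrite Hp Hq.
- have Hp : asat e s p <-> asat e' s' p.
    by apply: IHp => k kf; [apply: HN|apply: HS]; rewrite kf.
  have Hq : asat e s q <-> asat e' s' q.
    by apply: IHq => k kf; [apply: HN|apply: HS]; rewrite kf orbT.
  by rewrite Hp Hq.
- have H n : asat (upd e i n) s p <-> asat (upd e' i n) s' p.
    apply: IH => // k kf; rewrite /upd; case: eqP => // /eqP ki; apply: HN.
    by rewrite eq_sym ki.
  by split=> X n; apply/H.
- have H n : asat (upd e i n) s p <-> asat (upd e' i n) s' p.
    apply: IH => // k kf; rewrite /upd; case: eqP => // /eqP ki; apply: HN.
    by rewrite eq_sym ki.
  by split=> -[n X]; exists n; apply/H.
- have H X : asat e (upd s j X) p <-> asat e' (upd s' j X) p.
    apply: IH => // k kf; rewrite /upd; case: eqP => // /eqP kj; apply: HS.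
    by rewrite eq_sym kj.
  by split=> Y X; apply/H.
- have H X : asat e (upd s j X) p <-> asat e' (upd s' j X) p.
    apply: IH => // k kf; rewrite /upd; case: eqP => // /eqP kj; apply: HS.
    by rewrite eq_sym kj.
  by split=> -[X Y]; exists X; apply/H.
Qed.

(** * Arithmetical definition of the codes needed for the diagonal sentence *)

Definition numeral n := iter n ASucc AZero.

Lemma aeval_numeral e n : aeval e (numeral n) = n.
Proof. by elim: n => //= n ->. Qed.

(* The value is twice the Cantor pairing, whose division by 2 is not a term. *)
Definition pairing_term a b := APlus (ATimes (APlus a b) (ASucc (APlus a b))) (APlus b b).
Definition pairing_form z a b := AEq (APlus z z) (pairing_term a b).

Lemma aeval_pairing_term e a b :
  aeval e (pairing_term a b) = (cpair (aeval e a) (aeval e b)).*2.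
Proof. by rewrite -addnn double_cpair. Qed.

Lemma asat_pairing_form e s z a b :
  asat e s (pairing_form z a b) <-> aeval e z = cpair (aeval e a) (aeval e b).
Proof.
rewrite (_ : asat e s _ = (aeval e z + aeval e z = aeval e (pairing_term a b))%N) //.
by rewrite aeval_pairing_term addnn; split=> [/double_inj|->].
Qed.

Definition power_code n := gterm_code (pow_term (GVar 0) n).

Definition power_step k :=
  AImp (AMem (pairing_term (AVar k.+1) (AVar k.+2)) 0)
    (AImp (pairing_form (AVar k.+3) (numeral (gterm_code (GVar 0))) (AVar k.+2))
      (AImp (pairing_form (AVar k.+4) (numeral 2) (AVar k.+3))
        (AMem (pairing_term (ASucc (AVar k.+1)) (AVar k.+4)) 0))).

(** The recursion for the code of t^n is replaced by the least set of pairs closed under its step.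
    Variable 1 holds the input n and variable [k] the output; pairs enter the set as twice their
    code, since this is a term. *)
Definition power_form k :=
  AAllS 0 (AImp (AMem (pairing_term AZero (numeral (power_code 0))) 0)
    (AImp (AAllN k.+1 (AAllN k.+2 (AAllN k.+3 (AAllN k.+4 (power_step k)))))
      (AMem (pairing_term (AVar 1) (AVar k)) 0))).

Lemma asat_mem_pairing e s a b j :
  asat e s (AMem (pairing_term a b) j) <-> s j (cpair (aeval e a) (aeval e b)).*2.
Proof. by rewrite -aeval_pairing_term. Qed.

Lemma asat_power_step e s k : asat e s (power_step k) <->
  (s 0 (cpair (e k.+1) (e k.+2)).*2 -> e k.+3 = cpair (gterm_code (GVar 0)) (e k.+2) ->
   e k.+4 = cpair 2 (e k.+3) -> s 0 (cpair (e k.+1).+1 (e k.+4)).*2).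
Proof.
have A := asat_mem_pairing e s (AVar k.+1) (AVar k.+2) 0.
have B := asat_pairing_form e s (AVar k.+3) (numeral (gterm_code (GVar 0))) (AVar k.+2).
have C := asat_pairing_form e s (AVar k.+4) (numeral 2) (AVar k.+3).
have D := asat_mem_pairing e s (ASucc (AVar k.+1)) (AVar k.+4) 0.
rewrite aeval_numeral in B; rewrite aeval_numeral in C.
by split=> H; [move=> /A a /B b /C c; apply/D; exact: H
              |move=> /A a /B b /C c; apply/D; exact: H].
Qed.

Lemma asat_power_form e s k : asat e s (power_form k) <-> e k = power_code (e 1).
Proof.
have CL X : asat e (upd s 0 X) (AAllN k.+1 (AAllN k.+2 (AAllN k.+3 (AAllN k.+4 (power_step k))))) <->
    forall i w, X (cpair i w).*2 -> X (cpair i.+1 (cpair 2 (cpair (gterm_code (GVar 0)) w))).*2.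
  have E i w v w' : let e' := upd (upd (upd (upd e k.+1 i) k.+2 w) k.+3 v) k.+4 w' in
      [/\ e' k.+1 = i, e' k.+2 = w, e' k.+3 = v & e' k.+4 = w'].
    by rewrite /= /upd; split; do ?(case: eqP => //=); lia.
  split=> H i w.
    move: (H i w (cpair (gterm_code (GVar 0)) w) (cpair 2 (cpair (gterm_code (GVar 0)) w))).
    move=> /asat_power_step; rewrite upd_eq.
    by have [-> -> -> ->] := E i w (cpair (gterm_code (GVar 0)) w)
      (cpair 2 (cpair (gterm_code (GVar 0)) w)); move=> H' Xiw; exact: H'.
  move=> v w'; apply/asat_power_step; rewrite upd_eq.
  by have [-> -> -> ->] := E i w v w'; move=> Xiw -> ->; exact: H.
split.
  (* The graph of [power_code] is the closed set to which the hypothesis is applied. *)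
  pose X z := exists i, z = (cpair i (power_code i)).*2.
  have X0 : asat e (upd s 0 X) (AMem (pairing_term AZero (numeral (power_code 0))) 0).
    by apply/asat_mem_pairing; rewrite upd_eq aeval_numeral; exists 0.
  have XS : forall i w, X (cpair i w).*2 ->
      X (cpair i.+1 (cpair 2 (cpair (gterm_code (GVar 0)) w))).*2.
    move=> i w [i' /double_inj/cpair_inj [<- ->]]; exists i.+1; congr (cpair _ _).*2.
  move=> H; have /asat_mem_pairing : asat e (upd s 0 X) (AMem (pairing_term (AVar 1) (AVar k)) 0).
    exact: (H X X0 (iffRL (CL X) XS)).
  by rewrite upd_eq => -[i /double_inj/cpair_inj [<-]].
move=> ek X X0 /CL XS.
have {}X0 : asat e (upd s 0 X) (AMem (pairing_term AZero (numeral (power_code 0))) 0) := X0.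
suff : asat e (upd s 0 X) (AMem (pairing_term (AVar 1) (AVar k)) 0) by [].
apply/asat_mem_pairing; rewrite upd_eq -[aeval _ (AVar k)]/(e k) ek.
rewrite -[aeval _ (AVar 1)]/(e 1).
elim: (e 1) => [|n IH]; last exact: XS.
by move/asat_mem_pairing: X0; rewrite upd_eq aeval_numeral.
Qed.

(** Expressions for just those functions of n that the diagonal needs, so that no general
    representability of computable functions is required. *)
Inductive code_expr :=
  | CInput
  | CPower
  | CConst of nat
  | CPair of code_expr & code_expr.

Fixpoint code_eval (n : nat) (x : code_expr) : nat :=
  match x with
  | CInput => n
  | CPower => power_code n
  | CConst m => m
  | CPair x y => cpair (code_eval n x) (code_eval n y)
  end.

Fixpoint code_form (x : code_expr) (k : nat) : aform :=
  match x with
  | CInput => AEq (AVar k) (AVar 1)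
  | CPower => power_form k
  | CConst m => AEq (AVar k) (numeral m)
  | CPair x y => AExN k.+1 (AAnd (code_form x k.+1) (AExN k.+2 (AAnd (code_form y k.+2)
      (pairing_form (AVar k) (AVar k.+1) (AVar k.+2)))))
  end.

Lemma asat_code_form x k e s : 1 < k ->
  asat e s (code_form x k) <-> e k = code_eval (e 1) x.
Proof.
elim: x k e => [||m|x IHx y IHy] k e k1 //.
- exact: asat_power_form.
- by rewrite (_ : asat e s _ = (e k = aeval e (numeral m))) // aeval_numeral.
have X a : asat (upd e k.+1 a) s (code_form x k.+1) <-> a = code_eval (e 1) x.
  by rewrite IHx ?upd_eq ?upd_neq //; lia.
have Y a b : asat (upd (upd e k.+1 a) k.+2 b) s (code_form y k.+2) <-> b = code_eval (e 1) y.
  by rewrite IHy ?upd_eq ?upd_neq //; lia.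
have Z a b : asat (upd (upd e k.+1 a) k.+2 b) s (pairing_form (AVar k) (AVar k.+1) (AVar k.+2))
    <-> e k = cpair a b.
  rewrite asat_pairing_form /= upd_eq [X in cpair X _]upd_neq ?upd_eq ?upd_neq //; lia.
split=> [[a [/X -> [b [/Y -> /Z]]]]|E] //.
exists (code_eval (e 1) x); split; first exact/X.
exists (code_eval (e 1) y); split; first exact/Y.
exact/Z.
Qed.

(** The number n is supplied as t^n in variable 3, which is [nvar 0]. This avoids substitution into
    [body]: the code of the result depends on n only through a power term and the code of [body]. *)
Definition instance_form n (body : gform) :=
  GAll 0 (GAll 1 (GAll 2 (GAll 3
    (GImp (GAnd good_form (GEq (GVar 3) (pow_term (GVar 0) n))) body)))).

Definition iff_form p q := GAnd (GImp p q) (GImp q p).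

Definition instance_expr :=
  CPair (CConst 5) (CPair (CConst 0) (CPair (CConst 5) (CPair (CConst 1)
    (CPair (CConst 5) (CPair (CConst 2) (CPair (CConst 5) (CPair (CConst 3)
      (CPair (CConst 4) (CPair
        (CPair (CConst 2) (CPair (CConst (godel good_form))
          (CPair (CConst 0) (CPair (CConst (gterm_code (GVar 3))) CPower))))
        CInput))))))))).

Definition iff_expr m x :=
  CPair (CConst 2) (CPair (CPair (CConst 4) (CPair (CConst m) x))
    (CPair (CConst 4) (CPair x (CConst m)))).

Lemma instance_exprE n body : godel body = n ->
  code_eval n instance_expr = godel (instance_form n body).
Proof. by move=> {1 2}<-. Qed.

Lemma iff_exprE n x p q : code_eval n x = godel q ->
  code_eval n (iff_expr (godel p) x) = godel (iff_form p q).
Proof. by move=> E; rewrite -[RHS]/(cpair 2 (cpair (cpair 4 (cpair (godel p) (godel q)))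
    (cpair 4 (cpair (godel q) (godel p))))) -E. Qed.

Lemma good_form_free k : 3 < k -> gform_free k good_form = false.
(* The variables of [good_form] are all below 10, so past twelve cases every comparison with the
   index computes to false. *)
Proof. by do 12 (case: k => [//|k]); move=> _; vm_compute. Qed.

Lemma pow_term_free k s n : ~~ gterm_free k s -> ~~ gterm_free k (pow_term s n).
Proof. by move=> sk; elim: n => //= n IH; rewrite negb_or sk. Qed.

Lemma instance_form_sentence n body : (forall k, 3 < k -> ~~ gform_free k body) ->
  gsentence (instance_form n body).
Proof.
move=> H [|[|[|[|k]]]] //.
have pk : gterm_free k.+4 (pow_term (GVar 0) n) = false by apply/negbTE/pow_term_free.
rewrite -[gform_free _ _]/((gform_free k.+4 good_form || gterm_free k.+4 (pow_term (GVar 0) n))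
  || gform_free k.+4 body).
by rewrite good_form_free // pk /=; exact: H.
Qed.

Lemma iff_form_sentence p q : gsentence p -> gsentence q -> gsentence (iff_form p q).
Proof. by move=> P Q i; rewrite /iff_form /= (negbTE (P i)) (negbTE (Q i)). Qed.

Definition homeo_env (T : topologicalType) (t c r x : homeo T) : nat -> homeo T :=
  upd (upd (upd (upd (fun _ => homeo_one T) 0 t) 1 c) 2 r) 3 x.

Lemma models_instance (T : topologicalType) n p :
  compact_manifold T ->
  models_homeo T (instance_form n (close_off (iota 4 (gform_bound p)) p)) <->
  forall t c r : homeo T, good_params t c r ->
    gsat (G := Homeo T) (homeo_env t c r (homeo_pow t n)) p.
Proof.
move=> M.
have CO t c r x : gsat (G := Homeo T) (homeo_env t c r x)
    (close_off (iota 4 (gform_bound p)) p) <-> gsat (G := Homeo T) (homeo_env t c r x) p.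
  apply: sat_close_off => v; rewrite mem_iota => /andP[v4 _].
  by rewrite /homeo_env !upd_neq //; lia.
have B t c r x : based t c r (homeo_env t c r x) by [].
have X t c r x : gsat (G := Homeo T) (homeo_env t c r x)
    (GEq (GVar 3) (pow_term (GVar 0) n)) <-> x = homeo_pow t n.
  by rewrite sat_eq geval_pow.
split=> [H t c r g|H t c r x [g0 x0]].
  apply/CO/H; split; first exact: iffRL (sat_good (B _ t c r _)) g.
  exact: iffRL (X t c r _) erefl.
have g := iffLR (sat_good (B _ t c r x)) g0; have xn := iffLR (X t c r x) x0.
apply: (iffRL (CO t c r x)).
by rewrite xn; exact: H.
Qed.

Lemma models_translation (T : topologicalType) n K p :
  compact_manifold T -> 3 <= K -> aform_bound p <= K ->
  forall t c r : homeo T, good_params t c r ->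
  exists s, gsat (G := Homeo T) (homeo_env t c r (homeo_pow t n)) (translate_aform K p) <->
    asat (upd (fun _ => 0) 0 n) s p.
Proof.
move=> M K3 pK t c r g; have haus : hausdorff_space T by case: M.
have moving := manifold_locally_moving M; have lconn := manifold_locally_connected M.
(* All variables from 4 on hold the identity. As a set code it determines the set given here, and as
   a number it represents 0. *)
exists (fun _ n => member c (homeo_pow t n) (homeo_one T)).
apply: (sat_translate_aform haus moving lconn g) => //.
split=> [[|i] _|j _ a m am].
- by rewrite upd_eq; exact: rep_pow.
- have -> : homeo_env t c r (homeo_pow t n) (nvar i.+1) = homeo_one T.
    by rewrite /homeo_env /nvar !upd_neq //; lia.
  by rewrite upd_neq //; exact: rep_one.
- have -> : homeo_env t c r (homeo_pow t n) (svar j) = homeo_one T.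
    by rewrite /homeo_env /svar !upd_neq //; lia.
  exact: rep_member am.
Qed.

(** The input is copied to variable 1, where [code_form] reads it, and variable 0 is bound anew to
    the computed code. So [psi], whose free variable is 0, is used without substitution. *)
Definition diagonal_form (x : code_expr) (psi : aform) :=
  AExN 1 (AAnd (AEq (AVar 1) (AVar 0)) (AExN 0
    (AAnd (AExN 2 (AAnd (code_form x 2) (AEq (AVar 0) (AVar 2)))) (ANot psi)))).

Lemma asat_diagonal x psi e s :
  (forall k, k != 0 -> ~~ aform_freeN k psi) -> (forall k, ~~ aform_freeS k psi) ->
  asat e s (diagonal_form x psi) <->
  ~ asat (fun _ => code_eval (e 0) x) (fun _ _ => False) psi.
Proof.
move=> fN fS.
have P e' s' : asat e' s' psi <-> asat (fun _ => e' 0) (fun _ _ => False) psi.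
  apply: asat_free_imp => k; last by move/negP: (fS k).
  by case: (eqVneq k 0) => [->//|/fN/negP].
split.
  move=> [n [En [d [[d' [/asat_code_form Ed' Ed]] /P Npsi]]]].
  have {}En : n = e 0 := En; have {}Ed : d = d' := Ed.
  have {}Ed' : d' = code_eval n x := Ed' isT.
  by rewrite -En -Ed' -Ed.
move=> Npsi; exists (e 0); split=> //; exists (code_eval (e 0) x); split; last by move=> /P.
by exists (code_eval (e 0) x); split => //; apply/asat_code_form.
Qed.

Theorem theorem6p1 (C : mclass)
  (HCman : forall T : topologicalType, C T -> compact_manifold T)
  (HCinv : forall T T' : topologicalType, homeomorphic T T' -> C T -> C T')
  (HC : finitely_axiomatized C) :
  ~ so_definable (axiom_set C).
Proof.
move=> [psi [fN fS psiP]]; case: HC => phi [phi_sent phiP].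
pose x := iff_expr (godel phi) instance_expr.
(* [delta] says of a number [n] that the sentence obtained by feeding the formula with
   code [n] its own code does not axiomatize [C]. *)
pose delta := diagonal_form x psi.
pose K := maxn 3 (aform_bound delta).
pose p := translate_aform K delta.
(* Closing off all variables from 4 on makes the instance a sentence without a computation of the
   free variables of the translation. *)
pose body := close_off (iota 4 (gform_bound p)) p.
pose n := godel body.
pose L := iff_form phi (instance_form n body).
have codeL : code_eval n x = godel L by apply/iff_exprE/instance_exprE.
have sentence : gsentence (instance_form n body).
  apply: instance_form_sentence => k k3; rewrite close_off_free negb_and negbK.
  have [kp|_] := boolP (gform_free k p); last by rewrite orbT.
  by rewrite mem_iota k3 (leq_trans (gform_free_bound kp)) // leq_addl.
have L_sent : gsentence L by exact: (iff_form_sentence phi_sent sentence).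
(* The right-hand side mentions neither the manifold nor the parameters. *)
have truth T : compact_manifold T -> forall t c r : homeo T, good_params t c r ->
    gsat (G := Homeo T) (homeo_env t c r (homeo_pow t n)) p <-> ~ axiom_set C (godel L).
  move=> M t c r g.
  have [s ->] := models_translation n M (leq_maxl 3 _) (leq_maxr 3 (aform_bound delta)) g.
  by rewrite asat_diagonal // upd_eq codeL -psiP.
have AL : axiom_set C (godel L) <-> ~ axiom_set C (godel L).
  split=> [[L' [[_ L'P] /godel_inj E]]|NA].
    rewrite {}E in L'P.
    (* [L] and [phi] agree on the extended line, so the instance is true there. The good parameters
       on the line make it informative. *)
    have M := ereal_manifold; apply/(truth _ M _ _ _ line_good_params).
    have /(models_instance n p M) H : models_homeo (\bar Rdefinitions.R) (instance_form n body).
      have [CL LC] := L'P _ M; have [Cphi phiC] := phiP _ M.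
      have [c|nc] := pselect (C (\bar Rdefinitions.R)).
        by have [H _] := CL c; apply: H; exact: Cphi.
      (* If [phi] and the instance both failed here, [L] would hold and put the line in [C]. *)
      apply: contrapT => nI; apply: (nc); apply: LC; split; last by move=> /nI.
      by move=> /phiC/nc.
    exact: H _ _ _ line_good_params.
  (* Now the instance holds in every manifold, so [L] is equivalent to [phi] on manifolds. *)
  exists L; split => //; split => // T M.
  have I : models_homeo T (instance_form n body).
    by apply/(models_instance n p M) => t c r g; apply/(truth T M t c r g).
  rewrite phiP //; split=> [H|[_ H]]; last exact: H.
  by split.
have NA : ~ axiom_set C (godel L) by move=> A; exact: (AL.1 A A).
exact: NA (AL.2 NA).
Qed.
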